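(* Let $A$ be a ring and $\mathfrak a=(t)\subseteq A$ a principal ideal. Let $\phi\colon B\to\bar B$ be a surjective $A$-homomorphism of finitely generated $A$-algebras, and let $C$ and $\bar C$ be $A$-algebras such that: (1) $B$ and $\bar B$ are smooth over the complement of $V(\mathfrak a)$; (2) there is an exact sequence $0\to I\to C\xrightarrow{\varphi}\bar C\to 0$ with $\varphi$ a homomorphism of $A$-algebras; (3) the pairs $(C,\mathfrak aC)$ and $(\bar C,\mathfrak a\bar C)$ are henselian. Suppose we are given homomorphisms (of $A$-algebras) $\varepsilon\colon\widehat B\to\widehat C$ and $\bar\varepsilon\colon\widehat{\bar B}\to\widehat{\bar C}$ with $\widehat\varphi\circ\varepsilon=\bar\varepsilon\circ\widehat\phi$, where $\widehat\varphi\colon\widehat C\to\widehat{\bar C}$ and $\widehat\phi\colon\widehat B\to\widehat{\bar B}$ are the completions of $\varphi$ and $\phi$. Then for every natural number $n$ there exist $A$-homomorphisms $\gamma\colon B\to C$ and $\bar\gamma\colon\bar B\to\bar C$ such that $\varphi\circ\gamma=\bar\gamma\circ\phi$, the homomorphisms $\varepsilon$ and $\widehat\gamma$ from $\widehat B$ to $\widehat C$ coincide after composition with $\widehat C\to\widehat C/\mathfrak a^n\widehat C$, and the homomorphisms $\bar\varepsilon$ and $\widehat{\bar\gamma}$ from $\widehat{\bar B}$ to $\widehat{\bar C}$ coincide after composition with $\widehat{\bar C}\to\widehat{\bar C}/\mathfrak a^n\widehat{\bar C}$.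
   Context: All rings are commutative, unital and Noetherian (this applies to all the algebras named in the statement). The hat denotes $\mathfrak a$-adic completion of $A$-algebras and of homomorphisms. A finitely generated $A$-algebra $B$ is smooth over the complement of $V(\mathfrak a)$ if $B_t$ is smooth over $A_t$. For a ring $R$ with an ideal $\mathfrak b$, an étale homomorphism $R\to S$ is called strictly étale if it induces an isomorphism $R/\mathfrak b\to S/\mathfrak bS$; the pair $(R,\mathfrak b)$ is henselian if for every strictly étale homomorphism $\nu\colon R\to S$ there is a homomorphism $\mu\colon S\to R$ with $\mu\circ\nu=\mathrm{Id}_R$. *)

(* Defs.v *)
From HB Require Import structures.
From mathcomp Require Import all_boot all_algebra ring.
From mathcomp Require Import boolp classical_sets.

Set Implicit Arguments.
Unset Strict Implicit.
Unset Printing Implicit Defensive.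

Import GRing.Theory.

Local Open Scope classical_set_scope.
Local Open Scope ring_scope.
Local Open Scope quotient_scope.

(* Rings are [comPzRingType], so that the zero ring is allowed: localizations
   and completions of nonzero rings may vanish.  For the same reason algebras
   are not the library's [comAlgType]s, whose carriers are nonzero. *)

Record calg (A : comPzRingType) := CAlg {
  calg_ring :> comPzRingType;
  calg_map : {rmorphism A -> calg_ring}
}.
Arguments calg_map {A} B : rename.

Record ahom (A : comPzRingType) (B C : calg A) := AHom {
  ahom_fun :> {rmorphism B -> C};
  ahom_map : forall a : A, ahom_fun (calg_map B a) = calg_map C a
}.

Definition surj (S T : Type) (f : S -> T) : Prop := forall y, exists x, f x = y.

Section Ideals.
Variable R : comPzRingType.

Definition ideal_closed (I : set R) : Prop :=
  [/\ I 0, forall x y, I x -> I y -> I (x + y) & forall r x, I x -> I (r * x)].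

Record ideal := Ideal {
  ideal_set :> R -> Prop;
  idealP : ideal_closed ideal_set
}.

Lemma ideal_gen_closed (S : set R) : ideal_closed (smallest ideal_closed S).
Proof.
split=> [I [[]]//|x y Ix Iy I HI|r x Ix I HI].
  by case: (HI) => -[_ + _] _; apply; [apply: Ix|apply: Iy].
by case: (HI) => -[_ _ +] _; apply; apply: Ix.
Qed.

Definition ideal_gen (S : set R) : ideal := Ideal (ideal_gen_closed S).

Lemma ideal_unit_closed : ideal_closed [set: R].
Proof. by []. Qed.

Fixpoint ideal_pow (I : ideal) (n : nat) : ideal :=
  if n is m.+1
  then ideal_gen [set x * y | x in I & y in ideal_pow I m]
  else Ideal ideal_unit_closed.

Definition noetherian : Prop :=
  forall I : ideal, exists s : seq R, I = ideal_gen [set` s] :> (R -> Prop).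

Lemma idealN (I : ideal) x : I x -> I (- x).
Proof. by case: (idealP I) => _ _ IM Ix; rewrite -mulN1r; apply: IM. Qed.

Lemma idealB (I : ideal) x y : I x -> I y -> I (x - y).
Proof.
by case: (idealP I) => _ ID _ Ix Iy; apply: ID => //; apply: idealN.
Qed.

Lemma ideal_pow_sub (I : ideal) n : ideal_pow I n.+1 `<=` ideal_pow I n.
Proof.
apply: smallest_sub; first exact: idealP.
move=> _ [x Ix [y Iy <-]].
by case: (idealP (ideal_pow I n)) => _ _; apply.
Qed.

End Ideals.

Definition ext_ideal (A : comPzRingType) (a : ideal A) (B : calg A) : ideal B :=
  ideal_gen (calg_map B @` a).

Section Quotient.
Variables (R : comPzRingType) (I : ideal R).

Definition quot_rel : rel R := fun x y => `[< I (x - y) >].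

Lemma quot_relP : equiv_class_of quot_rel.
Proof.
have IN := @idealN _ I; case: (idealP I) => I0 ID _.
split=> [x|x y|y x z]; rewrite /quot_rel.
- by apply/asboolP; rewrite subrr.
- by apply/asboolP/asboolP => /IN; rewrite opprB.
- move=> /asboolP xy /asboolP yz; apply/asboolP.
  by rewrite -(subrKA y); apply: ID.
Qed.

Canonical quot_equiv := EquivRelPack quot_relP.

Definition quot := {eq_quot quot_equiv}.
HB.instance Definition _ := Choice.on quot.
HB.instance Definition _ := EqQuotient.on quot.

Definition quot_pi_fun (x : R) : quot := \pi_quot x.

Lemma quot_piP x y : quot_pi_fun x = quot_pi_fun y <-> I (x - y).
Proof.
by split=> [/eqmodP/asboolP//|Ixy]; apply/eqmodP/asboolP.
Qed.

Lemma quot_pi_surj : surj quot_pi_fun.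
Proof. by move=> y; exists (repr y); rewrite /quot_pi_fun reprK. Qed.

Let rep (u : quot) : R := repr u.

Let repK u : quot_pi_fun (rep u) = u. Proof. exact: reprK. Qed.

Let piK x : I (rep (quot_pi_fun x) - x).
Proof. by apply/quot_piP; rewrite repK. Qed.

Let qadd (u v : quot) := quot_pi_fun (rep u + rep v).
Let qopp (u : quot) := quot_pi_fun (- rep u).
Let qmul (u v : quot) := quot_pi_fun (rep u * rep v).

Let qaddE x y : qadd (quot_pi_fun x) (quot_pi_fun y) = quot_pi_fun (x + y).
Proof.
case: (idealP I) => _ ID _; apply/quot_piP; rewrite opprD addrACA.
exact: ID.
Qed.

Let qoppE x : qopp (quot_pi_fun x) = quot_pi_fun (- x).
Proof. by apply/quot_piP; rewrite -opprD; apply: idealN. Qed.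

Let qmulE x y : qmul (quot_pi_fun x) (quot_pi_fun y) = quot_pi_fun (x * y).
Proof.
case: (idealP I) => _ ID IM; apply/quot_piP.
set x' := rep _; set y' := rep _.
have -> : x' * y' - x * y = y' * (x' - x) + x * (y' - y).
  by rewrite !mulrBr (mulrC y' x') (mulrC y' x) addrA subrK.
by apply: ID; apply: IM; apply: piK.
Qed.

Let qind (P : quot -> Prop) : (forall x, P (quot_pi_fun x)) -> forall u, P u.
Proof. by move=> H u; rewrite -(repK u). Qed.

Let qaddA : associative qadd.
Proof.
elim/qind=> x; elim/qind=> y; elim/qind=> z.
by rewrite !qaddE addrA.
Qed.
Let qaddC : commutative qadd.
Proof. by elim/qind=> x; elim/qind=> y; rewrite !qaddE addrC. Qed.
Let qadd0 : left_id (quot_pi_fun 0) qadd.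
Proof. by elim/qind=> x; rewrite qaddE add0r. Qed.
Let qaddN : left_inverse (quot_pi_fun 0) qopp qadd.
Proof. by elim/qind=> x; rewrite qoppE qaddE addNr. Qed.
Let qmulA : associative qmul.
Proof.
elim/qind=> x; elim/qind=> y; elim/qind=> z.
by rewrite !qmulE mulrA.
Qed.
Let qmulC : commutative qmul.
Proof. by elim/qind=> x; elim/qind=> y; rewrite !qmulE mulrC. Qed.
Let qmul1 : left_id (quot_pi_fun 1) qmul.
Proof. by elim/qind=> x; rewrite qmulE mul1r. Qed.
Let qmulD : left_distributive qmul qadd.
Proof.
elim/qind=> x; elim/qind=> y; elim/qind=> z.
by rewrite !(qaddE, qmulE) mulrDl.
Qed.

HB.instance Definition _ :=
  GRing.isZmodule.Build quot qaddA qaddC qadd0 qaddN.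
HB.instance Definition _ :=
  GRing.Zmodule_isComPzRing.Build quot qmulA qmulC qmul1 qmulD.

Fact quot_pi_zmod : zmod_morphism quot_pi_fun.
Proof. by move=> x y; rewrite -qaddE -qoppE. Qed.
Fact quot_pi_monoid : monoid_morphism quot_pi_fun.
Proof. by split=> // x y; rewrite -qmulE. Qed.

HB.instance Definition _ :=
  GRing.isZmodMorphism.Build R quot quot_pi_fun quot_pi_zmod.
HB.instance Definition _ :=
  GRing.isMonoidMorphism.Build R quot quot_pi_fun quot_pi_monoid.

Definition quot_pi : {rmorphism R -> quot} := quot_pi_fun.

End Quotient.

Section QuotientMap.
Variables (R S : comPzRingType) (I : ideal R) (J : ideal S).
Variables (f : {rmorphism R -> S}) (fIJ : forall x, I x -> J (f x)).

Definition quot_map_fun (_ : forall x, I x -> J (f x)) (u : quot I) : quot J :=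
  quot_pi J (f (repr u)).

Lemma quot_mapE x : quot_map_fun fIJ (quot_pi I x) = quot_pi J (f x).
Proof.
apply/quot_piP; rewrite -rmorphB; apply: fIJ; apply/quot_piP.
exact: reprK.
Qed.

Fact quot_map_zmod : zmod_morphism (quot_map_fun fIJ).
Proof.
move=> u v; have [x <-] := quot_pi_surj u; have [y <-] := quot_pi_surj v.
by rewrite -[LHS]/(quot_map_fun _ (quot_pi I x - quot_pi I y)) -rmorphB
  !quot_mapE !rmorphB.
Qed.

Fact quot_map_monoid : monoid_morphism (quot_map_fun fIJ).
Proof.
split; first by rewrite -(rmorph1 (quot_pi I)) quot_mapE !rmorph1.
move=> u v; have [x <-] := quot_pi_surj u; have [y <-] := quot_pi_surj v.
by rewrite -[LHS]/(quot_map_fun _ (quot_pi I x * quot_pi I y)) -rmorphM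
  !quot_mapE !rmorphM.
Qed.

HB.instance Definition _ :=
  GRing.isZmodMorphism.Build (quot I) (quot J) (quot_map_fun fIJ) quot_map_zmod.
HB.instance Definition _ :=
  GRing.isMonoidMorphism.Build (quot I) (quot J) (quot_map_fun fIJ)
    quot_map_monoid.

Definition quot_map : {rmorphism quot I -> quot J} := quot_map_fun fIJ.

End QuotientMap.

(* The inverse limit of the rings R / I^n. *)
Section Completion.
Variables (R : comPzRingType) (I : ideal R).

Definition quot_trans n :
    {rmorphism quot (ideal_pow I n.+1) -> quot (ideal_pow I n)} :=
  quot_map (f := idfun) (@ideal_pow_sub R I n).

Record completion := Completion {
  completion_val :> forall n, quot (ideal_pow I n);
  completionP : forall n, quot_trans n (completion_val n.+1) = completion_val n
}.

HB.instance Definition _ := gen_eqMixin completion.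
HB.instance Definition _ := gen_choiceMixin completion.

Lemma completion_eq (u v : completion) : (forall n, u n = v n) -> u = v.
Proof.
case: u v => [u Hu] [v Hv] /= uv.
have E : u = v by apply: functional_extensionality_dep.
by case: _ / E Hv => Hv; congr Completion; apply: Prop_irrelevance.
Qed.

Let czero := @Completion (fun n => 0) (fun n => rmorph0 (quot_trans n)).
Let cone := @Completion (fun n => 1) (fun n => rmorph1 (quot_trans n)).

Fact completion_opp_proof (u : completion) n : quot_trans n (- u n.+1) = - u n.
Proof. by rewrite rmorphN completionP. Qed.
Fact completion_add_proof (u v : completion) n :
  quot_trans n (u n.+1 + v n.+1) = u n + v n.
Proof. by rewrite rmorphD !completionP. Qed.
Fact completion_mul_proof (u v : completion) n :
  quot_trans n (u n.+1 * v n.+1) = u n * v n.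
Proof. by rewrite rmorphM !completionP. Qed.

Let copp (u : completion) := @Completion (fun n => - u n) (completion_opp_proof u).
Let cadd (u v : completion) := @Completion (fun n => u n + v n) (completion_add_proof u v).
Let cmul (u v : completion) := @Completion (fun n => u n * v n) (completion_mul_proof u v).

Let caddA : associative cadd.
Proof. by move=> u v w; apply: completion_eq => n /=; rewrite addrA. Qed.
Let caddC : commutative cadd.
Proof. by move=> u v; apply: completion_eq => n /=; rewrite addrC. Qed.
Let cadd0 : left_id czero cadd.
Proof. by move=> u; apply: completion_eq => n /=; rewrite add0r. Qed.
Let caddN : left_inverse czero copp cadd.
Proof. by move=> u; apply: completion_eq => n /=; rewrite addNr. Qed.
Let cmulA : associative cmul.
Proof. by move=> u v w; apply: completion_eq => n /=; rewrite mulrA. Qed.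
Let cmulC : commutative cmul.
Proof. by move=> u v; apply: completion_eq => n /=; rewrite mulrC. Qed.
Let cmul1 : left_id cone cmul.
Proof. by move=> u; apply: completion_eq => n /=; rewrite mul1r. Qed.
Let cmulD : left_distributive cmul cadd.
Proof. by move=> u v w; apply: completion_eq => n /=; rewrite mulrDl. Qed.

HB.instance Definition _ :=
  GRing.isZmodule.Build completion caddA caddC cadd0 caddN.
HB.instance Definition _ :=
  GRing.Zmodule_isComPzRing.Build completion cmulA cmulC cmul1 cmulD.

Fact completion_of_proof (x : R) n :
  quot_trans n (quot_pi (ideal_pow I n.+1) x) = quot_pi (ideal_pow I n) x.
Proof. exact: quot_mapE. Qed.

Definition completion_of_fun (x : R) : completion :=
  @Completion (fun n => quot_pi (ideal_pow I n) x) (completion_of_proof x).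

Fact completion_of_zmod : zmod_morphism completion_of_fun.
Proof. by move=> x y; apply: completion_eq => n; apply: rmorphB. Qed.
Fact completion_of_monoid : monoid_morphism completion_of_fun.
Proof.
split=> [|x y]; apply: completion_eq => n; first exact: rmorph1.
exact: rmorphM.
Qed.

HB.instance Definition _ :=
  GRing.isZmodMorphism.Build R completion completion_of_fun completion_of_zmod.
HB.instance Definition _ :=
  GRing.isMonoidMorphism.Build R completion completion_of_fun
    completion_of_monoid.

Definition completion_of : {rmorphism R -> completion} := completion_of_fun.

End Completion.

Section CompletionMap.
Variables (R S : comPzRingType) (I : ideal R) (J : ideal S).
Variables (f : {rmorphism R -> S}) (fIJ : forall x, I x -> J (f x)).

Lemma ideal_pow_map n x : ideal_pow I n x -> ideal_pow J n (f x).
Proof.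
elim: n x => [//|n IHn].
pose K : set R := [set x | ideal_pow J n.+1 (f x)].
have [J0 JD JM] := idealP (ideal_pow J n.+1).
apply: (@smallest_sub _ (@ideal_closed R) _ K).
  rewrite /K; split=> [|x y|r x] /=.
  - by rewrite rmorph0.
  - by rewrite rmorphD; apply: JD.
  - by rewrite rmorphM; apply: JM.
move=> _ [x Ix [y Iy <-]]; rewrite /K /= rmorphM; apply: sub_gen_smallest.
by exists (f x); [apply: fIJ|exists (f y); first exact: IHn].
Qed.

Fact completion_map_proof (u : completion I) n :
  quot_trans J n (quot_map (@ideal_pow_map n.+1) (u n.+1))
  = quot_map (@ideal_pow_map n) (u n).
Proof.
rewrite -(completionP u n); have [x <-] := quot_pi_surj (u n.+1).
by rewrite /quot_trans /= !quot_mapE.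
Qed.

Definition completion_map_fun (u : completion I) : completion J :=
  Completion (completion_map_proof u).

Fact completion_map_zmod : zmod_morphism completion_map_fun.
Proof. by move=> x y; apply: completion_eq => n; apply: rmorphB. Qed.
Fact completion_map_monoid : monoid_morphism completion_map_fun.
Proof.
split=> [|x y]; apply: completion_eq => n; first exact: rmorph1.
exact: rmorphM.
Qed.

HB.instance Definition _ :=
  GRing.isZmodMorphism.Build (completion I) (completion J) completion_map_fun
    completion_map_zmod.
HB.instance Definition _ :=
  GRing.isMonoidMorphism.Build (completion I) (completion J) completion_map_fun
    completion_map_monoid.

Definition completion_map : {rmorphism completion I -> completion J} :=
  completion_map_fun.

Lemma completion_map_of x :
  completion_map (completion_of I x) = completion_of J (f x).
Proof. by apply: completion_eq => n; apply: quot_mapE. Qed.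

End CompletionMap.

Section AlgebraCompletion.
Variables (A : comPzRingType) (a : ideal A).

Definition hat (B : calg A) : calg A :=
  @CAlg A (completion (ext_ideal a B))
    (completion_of (ext_ideal a B) \o calg_map B).

Lemma ext_ideal_map (B C : calg A) (f : ahom B C) x :
  ext_ideal a B x -> ext_ideal a C (f x).
Proof.
pose K : set B := [set x | ext_ideal a C (f x)].
have [J0 JD JM] := idealP (ext_ideal a C).
apply: (@smallest_sub _ (@ideal_closed B) _ K).
  rewrite /K; split=> [|y z|r y] /=.
  - by rewrite rmorph0.
  - by rewrite rmorphD; apply: JD.
  - by rewrite rmorphM; apply: JM.
move=> _ [y ay <-]; rewrite /K /= ahom_map.
by apply: sub_gen_smallest; exists y.
Qed.

Fact hat_map_proof (B C : calg A) (f : ahom B C) (x : A) :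
  completion_map (@ext_ideal_map B C f) (calg_map (hat B) x)
  = calg_map (hat C) x.
Proof. by rewrite [LHS]completion_map_of ahom_map. Qed.

Definition hat_map (B C : calg A) (f : ahom B C) : ahom (hat B) (hat C) :=
  @AHom A (hat B) (hat C) (completion_map (@ext_ideal_map B C f))
    (hat_map_proof f).

End AlgebraCompletion.

(* The pair (x, n) stands for the fraction x / t^n. *)
Section Localization.
Variables (R : comPzRingType) (t : R).

Definition loc_rel : rel (R * nat) := fun u v =>
  `[< exists k, t ^+ k * (t ^+ v.2 * u.1) = t ^+ k * (t ^+ u.2 * v.1) >].

Lemma loc_relP : equiv_class_of loc_rel.
Proof.
split=> [[x n]|[x n] [y m]|[y m] [x n] [z l]]; rewrite /loc_rel /=.
- by apply/asboolP; exists 0%N.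
- by apply/asboolP/asboolP => -[k e]; exists k.
- move=> /asboolP[k e] /asboolP[k' e']; apply/asboolP.
  exists (k + k' + m)%N; rewrite !exprD.
  transitivity (t ^+ k' * t ^+ l * (t ^+ k * (t ^+ m * x))); first by ring.
  rewrite e; transitivity (t ^+ k * t ^+ n * (t ^+ k' * (t ^+ l * y))).
    by ring.
  by rewrite e'; ring.
Qed.

Canonical loc_equiv := EquivRelPack loc_relP.

Definition loc := {eq_quot loc_equiv}.
HB.instance Definition _ := Choice.on loc.
HB.instance Definition _ := EqQuotient.on loc.

Definition frac (x : R) (n : nat) : loc := \pi_loc (x, n).

Lemma fracP x n y m :
  frac x n = frac y m <->
  exists k, t ^+ k * (t ^+ m * x) = t ^+ k * (t ^+ n * y).
Proof. by split=> [/eqmodP/asboolP//|H]; apply/eqmodP/asboolP. Qed.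

Definition loc_num (u : loc) : R := (repr u).1.
Definition loc_exp (u : loc) : nat := (repr u).2.

Lemma loc_fracK u : frac (loc_num u) (loc_exp u) = u.
Proof. by rewrite /frac -surjective_pairing reprK. Qed.

Let fracK x n : exists k, t ^+ k * (t ^+ n * loc_num (frac x n)) =
  t ^+ k * (t ^+ (loc_exp (frac x n)) * x).
Proof. by apply/fracP; rewrite loc_fracK. Qed.

Let ladd (u v : loc) :=
  frac (t ^+ loc_exp v * loc_num u + t ^+ loc_exp u * loc_num v)
       (loc_exp u + loc_exp v).
Let lopp (u : loc) := frac (- loc_num u) (loc_exp u).
Let lmul (u v : loc) := frac (loc_num u * loc_num v) (loc_exp u + loc_exp v).

Let laddE x n y m :
  ladd (frac x n) (frac y m) = frac (t ^+ m * x + t ^+ n * y) (n + m).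
Proof.
have [k e] := fracK x n; have [k' e'] := fracK y m.
rewrite /ladd; move: (loc_num (frac x n)) (loc_exp (frac x n)) e.
move: (loc_num (frac y m)) (loc_exp (frac y m)) e' => y' m' e' x' n' e.
apply/fracP; exists (k + k')%N; rewrite !exprD.
transitivity (t ^+ k' * t ^+ m * t ^+ m' * (t ^+ k * (t ^+ n * x')) +
              t ^+ k * t ^+ n * t ^+ n' * (t ^+ k' * (t ^+ m * y'))).
  by ring.
by rewrite e e'; ring.
Qed.

Let loppE x n : lopp (frac x n) = frac (- x) n.
Proof.
have [k e] := fracK x n.
by apply/fracP; exists k; rewrite !mulrN e.
Qed.

Let lmulE x n y m : lmul (frac x n) (frac y m) = frac (x * y) (n + m).
Proof.
have [k e] := fracK x n; have [k' e'] := fracK y m.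
rewrite /lmul; move: (loc_num (frac x n)) (loc_exp (frac x n)) e.
move: (loc_num (frac y m)) (loc_exp (frac y m)) e' => y' m' e' x' n' e.
apply/fracP; exists (k + k')%N; rewrite !exprD.
transitivity ((t ^+ k * (t ^+ n * x')) * (t ^+ k' * (t ^+ m * y'))).
  by ring.
by rewrite e e'; ring.
Qed.

Let lind (P : loc -> Prop) : (forall x n, P (frac x n)) -> forall u, P u.
Proof. by move=> H u; rewrite -(loc_fracK u). Qed.

Let laddA : associative ladd.
Proof.
elim/lind=> x n; elim/lind=> y m; elim/lind=> z l.
by rewrite !laddE addnA; congr frac; rewrite !exprD; ring.
Qed.
Let laddC : commutative ladd.
Proof.
by elim/lind=> x n; elim/lind=> y m; rewrite !laddE addrC addnC.
Qed.
Let ladd0 : left_id (frac 0 0) ladd.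
Proof. by elim/lind=> x n; rewrite laddE mulr0 add0r expr0 mul1r. Qed.
Let laddN : left_inverse (frac 0 0) lopp ladd.
Proof.
elim/lind=> x n; rewrite loppE laddE.
by apply/fracP; exists 0%N; rewrite mulrN addNr !mulr0.
Qed.
Let lmulA : associative lmul.
Proof.
elim/lind=> x n; elim/lind=> y m; elim/lind=> z l.
by rewrite !lmulE addnA mulrA.
Qed.
Let lmulC : commutative lmul.
Proof.
by elim/lind=> x n; elim/lind=> y m; rewrite !lmulE mulrC addnC.
Qed.
Let lmul1 : left_id (frac 1 0) lmul.
Proof. by elim/lind=> x n; rewrite lmulE mul1r. Qed.
Let lmulD : left_distributive lmul ladd.
Proof.
elim/lind=> x n; elim/lind=> y m; elim/lind=> z l.
rewrite !(laddE, lmulE); apply/fracP; exists 0%N; rewrite !exprD; ring.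
Qed.

HB.instance Definition _ :=
  GRing.isZmodule.Build loc laddA laddC ladd0 laddN.
HB.instance Definition _ :=
  GRing.Zmodule_isComPzRing.Build loc lmulA lmulC lmul1 lmulD.

Lemma fracD x n y m :
  frac x n + frac y m = frac (t ^+ m * x + t ^+ n * y) (n + m).
Proof. exact: laddE. Qed.

Lemma fracN x n : - frac x n = frac (- x) n.
Proof. exact: loppE. Qed.

Lemma fracM x n y m : frac x n * frac y m = frac (x * y) (n + m).
Proof. exact: lmulE. Qed.

Lemma frac1 : frac 1 0 = 1.
Proof. by []. Qed.

End Localization.

Section LocalizationMap.
Variables (A : comPzRingType) (t : A) (B : calg A).

Definition loc_map_fun (u : loc t) : loc (calg_map B t) :=
  frac (calg_map B t) (calg_map B (loc_num u)) (loc_exp u).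

Lemma loc_mapE x n :
  loc_map_fun (frac t x n) = frac (calg_map B t) (calg_map B x) n.
Proof.
have /fracP[k e] := loc_fracK (frac t x n).
by apply/fracP; exists k; rewrite -!rmorphXn -!rmorphM e.
Qed.

Fact loc_map_zmod : zmod_morphism loc_map_fun.
Proof.
move=> u v; rewrite -(loc_fracK u) -(loc_fracK v).
by rewrite fracN fracD !loc_mapE fracN fracD rmorphD !rmorphM !rmorphXn rmorphN.
Qed.

Fact loc_map_monoid : monoid_morphism loc_map_fun.
Proof.
split=> [|u v]; first by rewrite -frac1 loc_mapE rmorph1.
rewrite -(loc_fracK u) -(loc_fracK v).
by rewrite fracM !loc_mapE fracM rmorphM.
Qed.

HB.instance Definition _ :=
  GRing.isZmodMorphism.Build (loc t) (loc (calg_map B t)) loc_map_fun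
    loc_map_zmod.
HB.instance Definition _ :=
  GRing.isMonoidMorphism.Build (loc t) (loc (calg_map B t)) loc_map_fun
    loc_map_monoid.

Definition loc_alg : calg (loc t) := @CAlg (loc t) (loc (calg_map B t)) loc_map_fun.

End LocalizationMap.

Section AlgebraProperties.
Variables (A : comPzRingType) (B : calg A).

Definition subalg_closed (S : set B) : Prop :=
  [/\ forall a, S (calg_map B a), forall x y, S x -> S y -> S (x + y)
    & forall x y, S x -> S y -> S (x * y)].

Definition finitely_generated : Prop :=
  exists s : seq B, smallest subalg_closed [set` s] = setT.

Definition square_zero_surj (T T' : calg A) (p : ahom T T') : Prop :=
  surj p /\ forall x y, p x = 0 -> p y = 0 -> x * y = 0.

Definition formally_smooth : Prop :=
  forall (T T' : calg A) (p : ahom T T'), square_zero_surj p ->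
  forall f : ahom B T', exists g : ahom B T, forall x, p (g x) = f x.

Definition formally_etale : Prop :=
  forall (T T' : calg A) (p : ahom T T'), square_zero_surj p ->
  forall f : ahom B T',
    (exists g : ahom B T, forall x, p (g x) = f x) /\
    (forall g h : ahom B T, (forall x, p (g x) = f x) ->
      (forall x, p (h x) = f x) -> forall x, g x = h x).

(* Smooth and etale algebras are only considered over noetherian rings, where
   finite generation amounts to finite presentation. *)
Definition smooth : Prop := finitely_generated /\ formally_smooth.
Definition etale : Prop := finitely_generated /\ formally_etale.

End AlgebraProperties.

Definition smooth_off (A : comPzRingType) (t : A) (B : calg A) : Prop :=
  smooth (loc_alg t B).

Section Henselian.
Variables (R : comPzRingType) (b : ideal R).

Lemma ext_ideal_calg_map (S : calg R) x : b x -> ext_ideal b S (calg_map S x).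
Proof. by move=> bx; apply: sub_gen_smallest; exists x. Qed.

Definition strictly_etale (S : calg R) : Prop :=
  etale S /\ bijective (quot_map (@ext_ideal_calg_map S)).

Definition henselian : Prop :=
  forall S : calg R, strictly_etale S ->
  exists mu : {rmorphism S -> R}, forall x, mu (calg_map S x) = x.

End Henselian.

(* Main.v *)
Require Import Defs.
From HB Require Import structures.
From mathcomp Require Import all_boot all_algebra ring.
From mathcomp Require Import boolp classical_sets.

(* Write B = P / J with P = A[X_1, ..., X_N] and J finitely generated.  Lifting
   the identity of B_t to (P / J^2)_t gives h_1, ..., h_N in J and c such that
   t^c f + sum_i D_i f * h_i lies in J^2 for f in J; differentiating,
   t^c D_l f + sum_i D_i f * D_l h_i lies in J.
   Suppose that x in C^N satisfies f(x) in t^m K for all f in J, where m is large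
   and K is an ideal of C.  The system
   h_i(y) = t^c (y_i - x_i) + sum_l D_l h_i(y) (y_l - x_l)
   is square, and with y = x + t^d u it takes the form u = a + t p(u) with a in
   K^N, so it has a solution since C is henselian, and u lies in K^N by
   Nakayama's lemma.  Multiplying by the D_i f(y), the two displayed properties
   of h give t^c f(y) in t^d J(y), so that t^c J(y) = 0, again by Nakayama; as the
   t-torsion of C is bounded and J(y) is contained in t^d C, J(y) = 0.  Hence y
   defines a homomorphism B -> C, congruent to x modulo t^d K.
   First apply this to Bbar and Cbar (with K = Cbar) to get gammabar.  Its
   composition with phi lifts to a point x of C^N which is close to eps; then
   f(x) lies in I and in t^m' C with m' large, hence in t^m I because the t-torsion
   of C / I is bounded.  Applying the construction with K = I gives gamma with
   varphi o gamma = gammabar o phi. *)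

Set Implicit Arguments.
Unset Strict Implicit.
Unset Printing Implicit Defensive.

Import GRing.Theory.

Local Open Scope classical_set_scope.
Local Open Scope ring_scope.
Local Open Scope quotient_scope.

(** * Ideals, kernels and factorization through a surjection *)

Section IdealTheory.
Variables (R : comPzRingType).
Implicit Types (I J : ideal R) (S : set R).

Lemma ideal0 I : I 0. Proof. by case: (idealP I). Qed.

Lemma idealD I x y : I x -> I y -> I (x + y).
Proof. by case: (idealP I) => _ + _; apply. Qed.

Lemma ideal_mull I r x : I x -> I (r * x).
Proof. by case: (idealP I) => _ _; apply. Qed.

Lemma ideal_mulr I r x : I x -> I (x * r).
Proof. by rewrite mulrC; apply: ideal_mull. Qed.

Lemma ideal_sum I (T : Type) (r : seq T) (P : pred T) (F : T -> R) :
  (forall i, P i -> I (F i)) -> I (\sum_(i <- r | P i) F i).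
Proof.
by move=> IF; elim/big_ind: _ => //; [apply: ideal0|apply: idealD].
Qed.

Lemma ideal_gen_sub S x : S x -> ideal_gen S x.
Proof. by move=> Sx; apply: sub_gen_smallest. Qed.

Lemma ideal_gen_min S I : S `<=` I -> ideal_gen S `<=` I.
Proof. by move=> SI; apply: smallest_sub => //; apply: idealP. Qed.

Lemma ideal_gen_seqP (s : seq R) x : ideal_gen [set` s] x ->
  exists c : nat -> R, x = \sum_(i < size s) c i * s`_i.
Proof.
pose K : set R := [set x | exists c : nat -> R, x = \sum_(i < size s) c i * s`_i].
move=> sx; apply: (@smallest_sub _ (@ideal_closed R) [set` s] K) sx.
  split.
  - by exists (fun=> 0); rewrite big1 // => i _; rewrite mul0r.
  - move=> _ _ [c ->] [d ->]; exists (fun i => c i + d i).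
    by rewrite -big_split /=; apply: eq_bigr => i _; rewrite mulrDl.
  - move=> r _ [c ->]; exists (fun i => r * c i).
    by rewrite big_distrr /=; apply: eq_bigr => i _; rewrite mulrA.
move=> y /= ys; exists (fun i => (i == index y s)%:R).
have ys' : (index y s < size s)%N by rewrite index_mem.
rewrite (bigD1 (Ordinal ys')) //= eqxx mul1r nth_index // big1 => [|i].
  by rewrite addr0.
by rewrite -val_eqE /= => /negPf ->; rewrite mul0r.
Qed.

Lemma ideal_genM1P (t x : R) : ideal_gen [set t] x <-> exists y, x = t * y.
Proof.
split=> [tx|[y ->]]; last by apply: ideal_mulr; apply: ideal_gen_sub.
pose K : set R := [set x | exists y, x = t * y].
apply: (@smallest_sub _ (@ideal_closed R) [set t] K) tx.
  split; first by exists 0; rewrite mulr0.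
    by move=> _ _ [y ->] [z ->]; exists (y + z); rewrite mulrDr.
  by move=> r _ [y ->]; exists (r * y); rewrite mulrCA.
by move=> _ ->; exists 1; rewrite mulr1.
Qed.

Lemma noetherian_gen I : noetherian R ->
  exists q (f : 'I_q -> R), (forall k, I (f k)) /\
    forall x, I x -> exists c : 'I_q -> R, x = \sum_k c k * f k.
Proof.
move=> /(_ I)[s Is]; exists (size s), (fun k => s`_k); split=> [k|x].
  by rewrite Is; apply: ideal_gen_sub; rewrite /= mem_nth.
by rewrite Is => /ideal_gen_seqP[c ->]; exists c.
Qed.

End IdealTheory.

Section IdealOps.
Variables (R : comPzRingType) (t : R).

Lemma ideal_pow_principal (b : ideal R) n x :
  (forall y, b y <-> exists z, y = t * z) ->
  ideal_pow b n x <-> exists z, x = t ^+ n * z.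
Proof.
move=> bt; elim: n x => [|n IHn] x /=.
  by split=> // _; exists x; rewrite mul1r.
split=> [nx|[z ->]].
  apply: (@smallest_sub _ (@ideal_closed R) _
    [set x | exists z, x = t ^+ n.+1 * z]) nx.
    split; first by exists 0; rewrite mulr0.
      by move=> _ _ [y ->] [z ->]; exists (y + z); rewrite mulrDr.
    by move=> r _ [y ->]; exists (r * y); rewrite mulrCA.
  move=> _ [u /bt[z ->] [v /IHn[w ->] <-]]; exists (z * w).
  by rewrite exprS; ring.
apply: ideal_gen_sub; exists t; first by apply/bt; exists 1; rewrite mulr1.
exists (t ^+ n * z); first by apply/IHn; exists z.
by rewrite exprS mulrA.
Qed.

End IdealOps.

Section RingKernel.
Variables (R S : comPzRingType) (f : {rmorphism R -> S}).

Lemma preim_ideal_closed (I : ideal S) : ideal_closed [set x | I (f x)].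
Proof.
split=> [|x y|r x] /=; rewrite ?rmorph0 ?rmorphD ?rmorphM.
- exact: ideal0.
- exact: idealD.
- exact: ideal_mull.
Qed.
Definition preim_ideal I : ideal R := Ideal (preim_ideal_closed I).

Lemma ker_closed : ideal_closed [set x | f x = 0].
Proof.
split=> [|x y|r x] /=; rewrite ?rmorph0 ?rmorphD ?rmorphM //.
  by move=> -> ->; rewrite addr0.
by move=> ->; rewrite mulr0.
Qed.
Definition ker : ideal R := Ideal ker_closed.

End RingKernel.

Section Factor.
Variables (A : comPzRingType) (P B C : calg A) (p : ahom P B) (psi : ahom P C).
Hypotheses (p_surj : surj p) (pk : forall x, p x = 0 -> psi x = 0).

Let lift (b : B) : P := projT1 (cid (p_surj b)).
Let liftK b : p (lift b) = b. Proof. exact: (projT2 (cid (p_surj b))). Qed.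

Lemma factor_eq x y : p x = p y -> psi x = psi y.
Proof.
move=> xy; apply/eqP; rewrite -subr_eq0 -rmorphB; apply/eqP/pk.
by rewrite rmorphB xy subrr.
Qed.

(** The vanishing hypothesis is an argument so that the morphism structures below, whose proofs use
    it, can be attached to this function. *)
Definition factor_fun (_ : forall x, p x = 0 -> psi x = 0) (b : B) : C :=
  psi (lift b).

Lemma factor_funE x : factor_fun pk (p x) = psi x.
Proof. by apply: factor_eq; rewrite liftK. Qed.

Fact factor_zmod : zmod_morphism (factor_fun pk).
Proof.
by move=> x y; rewrite -{1}(liftK x) -{1}(liftK y) -rmorphB factor_funE rmorphB.
Qed.
Fact factor_monoid : monoid_morphism (factor_fun pk).
Proof.
split=> [|x y]; first by rewrite -(rmorph1 p) factor_funE rmorph1.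
by rewrite -{1}(liftK x) -{1}(liftK y) -rmorphM factor_funE rmorphM.
Qed.
HB.instance Definition _ :=
  GRing.isZmodMorphism.Build B C (factor_fun pk) factor_zmod.
HB.instance Definition _ :=
  GRing.isMonoidMorphism.Build B C (factor_fun pk) factor_monoid.

Fact factor_map a : (factor_fun pk : {rmorphism B -> C}) (calg_map B a) = calg_map C a.
Proof. by rewrite -(ahom_map p) /= factor_funE ahom_map. Qed.

Lemma factor_ahom : exists g : ahom B C, forall x, g (p x) = psi x.
Proof. by exists (AHom factor_map) => x; apply: factor_funE. Qed.

End Factor.

Section AHomOps.
Variable A : comPzRingType.

Fact ahom_comp_map (B C D : calg A) (g : ahom C D) (f : ahom B C) a :
  (g \o f) (calg_map B a) = calg_map D a.
Proof. by rewrite /= !ahom_map. Qed.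
Definition ahom_comp (B C D : calg A) (g : ahom C D) (f : ahom B C) : ahom B D :=
  @AHom A B D (g \o f) (ahom_comp_map g f).

Definition quot_alg (B : calg A) (I : ideal B) : calg A :=
  @CAlg A (quot I) (quot_pi I \o calg_map B).

Fact quot_ahom_map (B : calg A) (I : ideal B) a :
  quot_pi I (calg_map B a) = calg_map (quot_alg I) a.
Proof. by []. Qed.
Definition quot_ahom (B : calg A) (I : ideal B) : ahom B (quot_alg I) :=
  @AHom A B (quot_alg I) (quot_pi I) (quot_ahom_map I).

Definition self_alg : calg A := @CAlg A A idfun.

End AHomOps.

Lemma quot_pi0 (R : comPzRingType) (I : ideal R) x : quot_pi I x = 0 <-> I x.
Proof.
split=> [|Ix]; last by rewrite -(rmorph0 (quot_pi I)); apply/quot_piP; rewrite subr0.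
by rewrite -{1}(rmorph0 (quot_pi I)) => /quot_piP; rewrite subr0.
Qed.

(** * Polynomial algebras and their derivations *)

(* The library's polynomials require a nonzero coefficient ring. *)
Section FreeAlgebra.
Variables (A : comPzRingType) (V : Type).

Inductive term : Type :=
| Var of V | Cst of A | Add of term & term | Mul of term & term.

Fixpoint eval (B : calg A) (e : V -> B) (u : term) : B :=
  match u with
  | Var v => e v
  | Cst a => calg_map B a
  | Add u v => eval e u + eval e v
  | Mul u v => eval e u * eval e v
  end.

HB.instance Definition _ := gen_eqMixin term.
HB.instance Definition _ := gen_choiceMixin term.

(* Identifying terms with the same value in every algebra makes the ring
   axioms automatic. *)
Definition term_rel : rel term := fun u v =>
  `[< forall (B : calg A) (e : V -> B), eval e u = eval e v >].

Lemma term_relP : equiv_class_of term_rel.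
Proof.
split=> [u|u v|v u w].
- exact/asboolP.
- by apply/asboolP/asboolP => uv B e; rewrite uv.
- by move=> /asboolP uv /asboolP vw; apply/asboolP => B e; rewrite uv vw.
Qed.
Canonical term_equiv := EquivRelPack term_relP.

Definition free := {eq_quot term_equiv}.
HB.instance Definition _ := Choice.on free.
HB.instance Definition _ := EqQuotient.on free.

Definition fpi (u : term) : free := \pi_free u.
Definition fev (B : calg A) (e : V -> B) (x : free) : B := eval e (repr x).

Lemma fevE (B : calg A) (e : V -> B) u : fev e (fpi u) = eval e u.
Proof.
suff /asboolP H : term_rel (repr (fpi u)) u by apply: H.
by apply/(@eqmodP _ term_equiv); rewrite reprK.
Qed.

Lemma fev_inj x y : (forall (B : calg A) (e : V -> B), fev e x = fev e y) -> x = y.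
Proof.
move=> H; rewrite -[x]reprK -[y]reprK.
by apply/(@eqmodP _ term_equiv)/asboolP.
Qed.

Let fadd (x y : free) := fpi (Add (repr x) (repr y)).
Let fmul (x y : free) := fpi (Mul (repr x) (repr y)).
(** Terms have no constructor for opposites, hence the multiplication by the constant -1. *)
Let fopp (x : free) := fpi (Mul (Cst (-1)) (repr x)).
Let fcst a := fpi (Cst a).

Let faddE (B : calg A) (e : V -> B) x y : fev e (fadd x y) = fev e x + fev e y.
Proof. exact: fevE. Qed.
Let fmulE (B : calg A) (e : V -> B) x y : fev e (fmul x y) = fev e x * fev e y.
Proof. exact: fevE. Qed.
Let foppE (B : calg A) (e : V -> B) x : fev e (fopp x) = - fev e x.
Proof. by rewrite fevE /= rmorphN1 mulN1r. Qed.
Let fcstE (B : calg A) (e : V -> B) a : fev e (fcst a) = calg_map B a.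
Proof. exact: fevE. Qed.
Let fE := (faddE, fmulE, foppE, fcstE, rmorph0, rmorph1).

Let faddA : associative fadd.
Proof. by move=> x y z; apply: fev_inj => D e; rewrite !fE addrA. Qed.
Let faddC : commutative fadd.
Proof. by move=> x y; apply: fev_inj => D e; rewrite !fE addrC. Qed.
Let fadd0 : left_id (fcst 0) fadd.
Proof. by move=> x; apply: fev_inj => D e; rewrite !fE add0r. Qed.
Let faddN : left_inverse (fcst 0) fopp fadd.
Proof. by move=> x; apply: fev_inj => D e; rewrite !fE addNr. Qed.
Let fmulA : associative fmul.
Proof. by move=> x y z; apply: fev_inj => D e; rewrite !fE mulrA. Qed.
Let fmulC : commutative fmul.
Proof. by move=> x y; apply: fev_inj => D e; rewrite !fE mulrC. Qed.
Let fmul1 : left_id (fcst 1) fmul.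
Proof. by move=> x; apply: fev_inj => D e; rewrite !fE mul1r. Qed.
Let fmulD : left_distributive fmul fadd.
Proof. by move=> x y z; apply: fev_inj => D e; rewrite !fE mulrDl. Qed.

HB.instance Definition _ := GRing.isZmodule.Build free faddA faddC fadd0 faddN.
HB.instance Definition _ :=
  GRing.Zmodule_isComPzRing.Build free fmulA fmulC fmul1 fmulD.

Fact fcst_zmod : zmod_morphism fcst.
Proof.
move=> x y; apply: fev_inj => D e.
by rewrite [RHS]faddE foppE !fcstE rmorphB.
Qed.
Fact fcst_monoid : monoid_morphism fcst.
Proof.
by split=> // x y; apply: fev_inj => D e; rewrite [RHS]fmulE !fcstE rmorphM.
Qed.
HB.instance Definition _ := GRing.isZmodMorphism.Build A free fcst fcst_zmod.
HB.instance Definition _ := GRing.isMonoidMorphism.Build A free fcst fcst_monoid.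

Definition free_alg : calg A := @CAlg A free fcst.

Definition gen (v : V) : free_alg := fpi (Var v).

Section FreeHom.
Variables (B : calg A) (e : V -> B).

Fact fev_zmod : zmod_morphism (fev e : free -> B).
Proof. by move=> x y; rewrite [LHS]faddE foppE. Qed.
Fact fev_monoid : monoid_morphism (fev e : free -> B).
Proof. by split=> [|x y]; [rewrite [LHS]fcstE rmorph1|apply: fmulE]. Qed.
HB.instance Definition _ := GRing.isZmodMorphism.Build free B (fev e) fev_zmod.
HB.instance Definition _ := GRing.isMonoidMorphism.Build free B (fev e) fev_monoid.

Fact free_hom_map a :
  (fev e : {rmorphism free -> B}) (calg_map free_alg a) = calg_map B a.
Proof. exact: fcstE. Qed.
Definition free_hom : ahom free_alg B := @AHom A free_alg B (fev e) free_hom_map.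

Lemma free_hom_gen v : free_hom (gen v) = e v. Proof. exact: fevE. Qed.

End FreeHom.

Lemma free_ind (K : set free_alg) :
  (forall a, K (calg_map free_alg a)) -> (forall v, K (gen v)) ->
  (forall x y, K x -> K y -> K (x + y)) -> (forall x y, K x -> K y -> K (x * y)) ->
  forall x, K x.
Proof.
move=> KA KV KD KM x; rewrite -[x]reprK; move: (repr x) => u {x}.
rewrite -[\pi_free u]/(fpi u).
elim: u => [v|a|u IHu v IHv|u IHu v IHv]; [exact: KV|exact: KA| |].
- suff -> : fpi (Add u v) = (fpi u : free_alg) + fpi v by apply: KD.
  by apply: fev_inj => D e; rewrite [RHS]faddE !fevE.
- suff -> : fpi (Mul u v) = (fpi u : free_alg) * fpi v by apply: KM.
  by apply: fev_inj => D e; rewrite [RHS]fmulE !fevE.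
Qed.

Lemma free_hom_eq (B : calg A) (f g : ahom free_alg B) :
  (forall v, f (gen v) = g (gen v)) -> forall x, f x = g x.
Proof.
move=> fg; apply: free_ind => [a|//|x y|x y] /=; rewrite ?ahom_map //.
  by rewrite !rmorphD => -> ->.
by rewrite !rmorphM => -> ->.
Qed.

End FreeAlgebra.

Section DualNumbers.
Variable R : comPzRingType.

(* The pair (x, y) stands for x + y eps, where eps ^ 2 = 0. *)
Definition dual := (R * R)%type.
HB.instance Definition _ := GRing.Zmodule.on dual.

Let dmul (u v : dual) : dual := (u.1 * v.1, u.1 * v.2 + u.2 * v.1).

Let dmulA : associative dmul.
Proof. by move=> u v w; congr pair => /=; ring. Qed.
Let dmulC : commutative dmul.
Proof. by move=> u v; congr pair => /=; ring. Qed.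
Let dmul1 : left_id (1, 0) dmul.
Proof. by case=> x y; congr pair => /=; ring. Qed.
Let dmulD : left_distributive dmul +%R.
Proof. by move=> u v w; congr pair => /=; ring. Qed.

HB.instance Definition _ :=
  GRing.Zmodule_isComPzRing.Build dual dmulA dmulC dmul1 dmulD.

Lemma dualM (u v : dual) : u * v = (u.1 * v.1, u.1 * v.2 + u.2 * v.1) :> dual.
Proof. by []. Qed.

Definition dual_cst_fun (x : R) : dual := (x, 0).
Fact dual_cst_zmod : zmod_morphism dual_cst_fun.
Proof. by move=> x y; congr pair; rewrite subr0. Qed.
Fact dual_cst_monoid : monoid_morphism dual_cst_fun.
Proof. by split=> // x y; rewrite dualM /= mulr0 mul0r addr0. Qed.
HB.instance Definition _ :=
  GRing.isZmodMorphism.Build R dual dual_cst_fun dual_cst_zmod.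
HB.instance Definition _ :=
  GRing.isMonoidMorphism.Build R dual dual_cst_fun dual_cst_monoid.
Definition dual_cst : {rmorphism R -> dual} := dual_cst_fun.

End DualNumbers.

Section Derivation.
Variables (A : comPzRingType) (V : finType).
Let P := free_alg A V.

Definition dual_alg : calg A := @CAlg A (dual P) (dual_cst P \o calg_map P).

Definition dual_hom (v : V) : ahom P dual_alg :=
  @free_hom A V dual_alg (fun w => (gen A w, (w == v)%:R)).

(** This is the coefficient of eps in [f(X + eps e_v)]; additivity and the Leibniz rule are
    inherited from the ring of dual numbers. *)
Definition pderiv (v : V) (f : P) : P := (dual_hom v f : dual P).2.

Lemma dual_hom1 v f : (dual_hom v f : dual P).1 = f.
Proof.
apply: (@free_ind A V [set f | (dual_hom v f : dual P).1 = f]) => /=.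
- by move=> a; rewrite (ahom_map (dual_hom v)).
- by move=> w; rewrite [free_hom _ _]free_hom_gen.
- by move=> x y xE yE; rewrite (rmorphD (dual_hom v)) /= xE yE.
- by move=> x y xE yE; rewrite (rmorphM (dual_hom v)) dualM /= xE yE.
Qed.

Lemma pderiv_cst v a : pderiv v (calg_map P a) = 0.
Proof. by rewrite /pderiv (ahom_map (dual_hom v)). Qed.

Lemma pderiv_gen v w : pderiv v (gen A w) = (w == v)%:R.
Proof. by rewrite /pderiv [dual_hom _ _]free_hom_gen. Qed.

Lemma pderivD v f g : pderiv v (f + g) = pderiv v f + pderiv v g.
Proof. by rewrite /pderiv rmorphD. Qed.

Lemma pderivM v f g : pderiv v (f * g) = f * pderiv v g + pderiv v f * g.
Proof. by rewrite /pderiv rmorphM dualM /= !dual_hom1. Qed.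

Lemma pderiv_sum v (T : Type) (r : seq T) (F : T -> P) :
  pderiv v (\sum_(i <- r) F i) = \sum_(i <- r) pderiv v (F i).
Proof.
elim: r => [|i r IHr]; last by rewrite !big_cons pderivD IHr.
by rewrite !big_nil -(rmorph0 (calg_map P)) pderiv_cst rmorph0.
Qed.

Section Taylor.
Variables (T : calg A) (al be : ahom P T) (u : V -> T).
Hypothesis beE : forall v, be (gen A v) = al (gen A v) + u v.

(** Modulo [M] the homomorphisms [al] and [be] agree on the variables, hence everywhere. *)
Lemma taylor1 (M : ideal T) : (forall v, M (u v)) -> forall f, M (be f - al f).
Proof.
move=> Mu f; apply/quot_piP.
apply: (@free_hom_eq _ _ _ (ahom_comp (quot_ahom M) be)
                           (ahom_comp (quot_ahom M) al)) => v /=.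
by apply/quot_piP; rewrite beE addrC addKr.
Qed.

(** Induction on [f]: the error for a product is a combination of the errors of its factors and of
    the product of their linear terms, which is in [M] because all [u v * u w] are. *)
Lemma taylor2 (M : ideal T) : (forall v w, M (u v * u w)) ->
  forall f, M (be f - (al f + \sum_v al (pderiv v f) * u v)).
Proof.
move=> Mu.
pose L f := \sum_v al (pderiv v f) * u v.
have LL f g : M (L f * L g).
  rewrite /L big_distrlr /=; apply: ideal_sum => v _; apply: ideal_sum => w _.
  by rewrite mulrACA; apply: ideal_mull.
apply: (@free_ind A V [set f | M (be f - (al f + L f))]) => /=.
- move=> a; rewrite /L !ahom_map big1 ?addr0 ?subrr; first exact: ideal0.
  by move=> v _; rewrite pderiv_cst rmorph0 mul0r.
- move=> v; rewrite beE /L (bigD1 v) //= pderiv_gen eqxx rmorph1 mul1r.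
  rewrite big1 ?addr0 ?subrr; first exact: ideal0.
  by move=> w wv; rewrite pderiv_gen eq_sym (negPf wv) rmorph0 mul0r.
- move=> f g Mf Mg.
  have -> : L (f + g) = L f + L g.
    rewrite -big_split /=; apply: eq_bigr => v _.
    by rewrite pderivD rmorphD mulrDl.
  rewrite !rmorphD [al f + al g + _]addrACA opprD addrACA.
  exact: idealD.
- move=> f g Mf Mg.
  have -> : L (f * g) = al f * L g + L f * al g.
    rewrite /L big_distrr big_distrl -big_split /=; apply: eq_bigr => v _.
    by rewrite pderivM rmorphD !rmorphM; ring.
  rewrite !rmorphM.
  set m : T := be f - _ in Mf; set m' : T := be g - _ in Mg.
  have -> : be f * be g - (al f * al g + (al f * L g + L f * al g)) =
            L f * L g + m * be g + (al f + L f) * m'.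
    by rewrite /m /m'; ring.
  by apply: idealD; [apply: idealD; [apply: LL|apply: ideal_mulr]|apply: ideal_mull].
Qed.

End Taylor.

Lemma taylor_square_zero (T : calg A) (al be : ahom P T) (u : V -> T) :
  (forall v, be (gen A v) = al (gen A v) + u v) ->
  (forall v w, u v * u w = 0) ->
  forall f, be f = al f + \sum_v al (pderiv v f) * u v.
Proof.
move=> beE uu f; apply/eqP; rewrite -subr_eq0; apply/eqP.
(* [ker idfun] is the zero ideal. *)
exact: (@taylor2 T al be u beE (ker idfun)).
Qed.

End Derivation.

(** Finitely many bounds are replaced by their maximum. *)
Lemma ex_uniform q (Q : 'I_q -> nat -> Prop) :
  (forall i c c', (c <= c')%N -> Q i c -> Q i c') ->
  (forall i, exists c, Q i c) -> exists c, forall i, Q i c.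
Proof.
move=> Qle /choice[c Qc]; exists (\max_i c i)%N => i.
exact: Qle (leq_bigmax _) (Qc i).
Qed.

(** * Ascending chains and bounded torsion *)

Section NoetherianChain.
Variables (R : comPzRingType) (noethR : noetherian R).

(** The union of the chain is an ideal, and its finitely many generators all lie in a single
    term. *)
Lemma noetherian_chain (F : nat -> ideal R) :
  (forall n x, F n x -> F n.+1 x) -> exists m, forall n x, F n x -> F m x.
Proof.
move=> FS.
have Fle i j x : (i <= j)%N -> F i x -> F j x.
  by move=> /subnK <- Fx; elim: (j - i)%N => // k; rewrite addSn => /FS.
have U_closed : ideal_closed [set x | exists n, F n x].
  split=> [|x y [i Fx] [j Fy]|r x [i Fx]]; first by exists 0%N; apply: ideal0.
    exists (maxn i j); apply: idealD.
      exact: Fle (leq_maxl _ _) Fx.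
    exact: Fle (leq_maxr _ _) Fy.
  by exists i; apply: ideal_mull.
have [q [f [Uf fgen]]] := noetherian_gen (Ideal U_closed) noethR.
have [m Fm] := @ex_uniform q (fun i n => F n (f i)) (fun i c c' => @Fle c c' _) Uf.
exists m => n x Fx; have [|c ->] := fgen x; first by exists n.
by apply: ideal_sum => i _; apply: ideal_mull.
Qed.

Lemma torsion_closed (t : R) (I : ideal R) k :
  ideal_closed [set v | I (t ^+ k * v)].
Proof.
split=> [|x y|r x] /=; rewrite ?mulr0 ?mulrDr.
- exact: ideal0.
- exact: idealD.
- by rewrite mulrCA; apply: ideal_mull.
Qed.

(** The ideals [(I : t^k)] form an ascending chain. The result bounds the t-torsion of [R / I], and
    that of [R] when [I] is zero. *)
Lemma bounded_torsion (t : R) (I : ideal R) :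
  exists e, forall k v, I (t ^+ k * v) -> I (t ^+ e * v).
Proof.
apply: (@noetherian_chain (fun k => Ideal (@torsion_closed t I k))) => n x /=.
by rewrite exprS -mulrA; apply: ideal_mull.
Qed.

End NoetherianChain.

Lemma noetherian_surj (R S : comPzRingType) (f : {rmorphism R -> S}) :
  surj f -> noetherian R -> noetherian S.
Proof.
move=> f_surj noethR I; have [q [g [Ig gen_g]]] :=
  noetherian_gen (preim_ideal f I) noethR.
exists [seq f (g k) | k <- enum 'I_q]; apply/funext => y; apply/propext; split.
  have [x <-] := f_surj y => /gen_g[c ->]; rewrite rmorph_sum.
  apply: ideal_sum => k _; rewrite rmorphM; apply: ideal_mull; apply: ideal_gen_sub.
  by apply: map_f; rewrite mem_enum.
by apply: ideal_gen_min => _ /mapP[k _ ->]; apply: Ig.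
Qed.

(** * Hilbert's basis theorem *)

Section Adjoin.
Variables (R : comPzRingType) (S : calg R) (x : S).
Local Notation "r %:S" := (calg_map S r) (at level 2, format "r %:S").

(** The expression need not be unique, as [x] may be algebraic over [R]; the bound [n] takes the
    place of a degree. *)
Definition poly_upto n : set S :=
  [set g | exists r : nat -> R, g = \sum_(i < n) (r i)%:S * x ^+ i].

Lemma poly_upto0 g : poly_upto 0 g <-> g = 0.
Proof.
by split=> [[r ->]|->]; [rewrite big_ord0|exists (fun=> 0); rewrite big_ord0].
Qed.

Lemma poly_uptoS n g :
  poly_upto n.+1 g <-> exists r, poly_upto n (g - r%:S * x ^+ n).
Proof.
split=> [[r ->]|[a [r gE]]].
  by exists (r n), r; rewrite big_ord_recr addrK.
exists (fun i => if (i < n)%N then r i else a); rewrite big_ord_recr /= ltnn.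
have -> : \sum_(i < n) (if (i < n)%N then r i else a)%:S * x ^+ i =
          \sum_(i < n) (r i)%:S * x ^+ i.
  by apply: eq_bigr => i _; rewrite ltn_ord.
by rewrite -gE subrK.
Qed.

Lemma poly_uptoD n g h : poly_upto n g -> poly_upto n h -> poly_upto n (g + h).
Proof.
move=> [r ->] [s ->]; exists (fun i => r i + s i); rewrite -big_split.
by apply: eq_bigr => i _; rewrite rmorphD mulrDl.
Qed.

Lemma poly_uptoZ n a g : poly_upto n g -> poly_upto n (a%:S * g).
Proof.
move=> [r ->]; exists (fun i => a * r i); rewrite big_distrr /=.
by apply: eq_bigr => i _; rewrite rmorphM mulrA.
Qed.

Lemma poly_uptoX n k g : poly_upto n g -> poly_upto (n + k) (x ^+ k * g).
Proof.
elim: k => [|k IHk] in n g *; first by rewrite addn0 mul1r.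
move=> [r ->]; rewrite exprSr -mulrA addnS -addSn; apply: IHk.
exists (fun i => if i is j.+1 then r j else 0); rewrite big_ord_recl /=.
rewrite rmorph0 mul0r add0r big_distrr /=.
by apply: eq_bigr => i _; rewrite exprS mulrCA.
Qed.

Lemma poly_upto_leq n k g : (n <= k)%N -> poly_upto n g -> poly_upto k g.
Proof.
move=> /subnK <-; elim: (k - n)%N => // d IHd /IHd ng.
by rewrite addSn; apply/poly_uptoS; exists 0; rewrite rmorph0 mul0r subr0.
Qed.

Lemma poly_upto_closed (y : S) g :
  (exists n, poly_upto n y) -> (exists n, poly_upto n g) ->
  exists n, poly_upto n (y * g).
Proof.
move=> [n [r ->]] [m mg]; exists (m + n)%N; elim: n => [|n IHn].
  by rewrite big_ord0 mul0r; exists (fun=> 0); rewrite big1 // => i _;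
    rewrite rmorph0 mul0r.
rewrite big_ord_recr mulrDl; apply: poly_uptoD.
  by apply: poly_upto_leq IHn; rewrite addnS.
rewrite -mulrA; apply: poly_uptoZ.
by apply: poly_upto_leq (poly_uptoX n mg); rewrite addnS.
Qed.

Hypothesis noethR : noetherian R.
Hypothesis S_poly : forall y : S, exists n, poly_upto n y.

(** These are the coefficients that [x ^+ n] can have in expressions of degree at most [n] for
    elements of [I]. Multiplication by [x] shows that they increase with [n]. *)
Lemma lead_closed (I : ideal S) n :
  ideal_closed [set r | exists2 g, I g & poly_upto n (g - r%:S * x ^+ n)].
Proof.
split=> [|r s [g Ig rg] [h Ih sh]|a r [g Ig rg]].
- exists 0; first exact: ideal0.
  by exists (fun=> 0); rewrite big1 => [|i _]; rewrite rmorph0 mul0r ?subrr.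
- exists (g + h); first exact: idealD.
  by rewrite rmorphD mulrDl opprD addrACA; apply: poly_uptoD.
- exists (a%:S * g); first exact: ideal_mull.
  by rewrite rmorphM -mulrA -mulrBr; apply: poly_uptoZ.
Qed.
Definition lead I n : ideal R := Ideal (@lead_closed I n).

Lemma lead_mono n k r g : (n <= k)%N -> poly_upto n (g - r%:S * x ^+ n) ->
  poly_upto k (x ^+ (k - n) * g - r%:S * x ^+ k).
Proof.
move=> nk /(@poly_uptoX _ (k - n)).
by rewrite mulrBr mulrCA -exprD subnK // subnKC.
Qed.

(** For each degree below [n], finitely many elements of [I] are collected whose leading
    coefficients generate the ideal [lead I k]. *)
Lemma lead_gens (I : ideal S) n : exists s : seq S, (forall y, y \in s -> I y) /\
  forall k r, (k < n)%N -> lead I k r ->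
    exists2 g, ideal_gen [set` s] g & poly_upto k (g - r%:S * x ^+ k).
Proof.
elim: n => [|n [s [Is sP]]]; first by exists [::]; split.
have [q [f [lf fgen]]] := noetherian_gen (lead I n) noethR.
have /choice[g gP] : forall k, exists g,
    I g /\ poly_upto n (g - (f k)%:S * x ^+ n).
  by move=> k; have [g] := lf k; exists g.
exists (s ++ [seq g k | k <- enum 'I_q]); split=> [y|k r].
  by rewrite mem_cat => /orP[/Is//|/mapP[k _ ->]]; case: (gP k).
rewrite ltnS leq_eqVlt => /orP[/eqP->|kn] lr; last first.
  have [h sh kh] := sP k r kn lr; exists h => //.
  apply: ideal_gen_min sh => y /= ys; apply: ideal_gen_sub.
  by rewrite /= mem_cat ys.
have [c ->] := fgen r lr.
exists (\sum_i (c i)%:S * g i).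
  apply: ideal_sum => i _; apply: ideal_mull; apply: ideal_gen_sub.
  by rewrite /= mem_cat map_f ?orbT // mem_enum.
rewrite rmorph_sum big_distrl -sumrB /=.
elim/big_ind: _ => [|y z|i _]; last 1 first.
- by rewrite rmorphM -mulrA -mulrBr; apply: poly_uptoZ; case: (gP i).
- by exists (fun=> 0); rewrite big1 // => i _; rewrite rmorph0 mul0r.
- exact: poly_uptoD.
Qed.

Lemma noetherian_adjoin : noetherian S.
Proof.
move=> I.
have [|m leadm] := noetherian_chain noethR (F := lead I).
  move=> n r [g Ig ng]; exists (x ^+ 1 * g); first exact: ideal_mull.
  by rewrite -(subSnn n); apply: lead_mono.
have [s [Is sP]] := lead_gens I m.+1.
exists s; apply/funext => g; apply/propext; split; last first.
  exact: ideal_gen_min.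
have [n ng] := S_poly g.
elim: n g ng => [|n IHn] g; first by move=> /poly_upto0-> _; apply: ideal0.
move=> /poly_uptoS[r ng] Ig.
(* The leading term of [g] is cancelled in degree [n] itself if [n <= m]. Beyond [m] the leading
   ideals are stationary, and an element of degree [m] is multiplied by [x ^+ (n - m)]. *)
have [k kn [km lr]] : exists2 k, (k <= n)%N & (k < m.+1)%N /\ lead I k r.
  have lr : lead I n r by exists g.
  case: (leqP n m) => nm; first by exists n.
    by exists m; [apply: ltnW|split=> //; apply: leadm lr].
have [w sw kw] := sP k r km lr.
rewrite -[g](subrK (x ^+ (n - k) * w)); apply: idealD; last exact: ideal_mull.
apply: IHn.
  have /(poly_uptoZ (- 1)) := lead_mono kn kw.
  move/(poly_uptoD ng); rewrite rmorphN1 mulN1r opprB addrA subrK.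
  by [].
apply: idealB => //; apply: ideal_mull.
by apply: ideal_gen_min sw => y; apply: Is.
Qed.

End Adjoin.

(** Induction on [N]: the last variable generates the algebra over the image of the polynomials in
    the other ones. *)
Lemma noetherian_free (A : comPzRingType) N :
  noetherian A -> noetherian (free_alg A 'I_N).
Proof.
move=> noethA; elim: N => [|N IHN].
  apply: (noetherian_surj (f := calg_map (free_alg A 'I_0)) _ noethA).
  apply: (@free_ind A 'I_0 [set y | exists a, calg_map (free_alg A 'I_0) a = y]).
  - by move=> a; exists a.
  - by case.
  - by move=> _ _ [a <-] [b <-]; exists (a + b); rewrite rmorphD.
  - by move=> _ _ [a <-] [b <-]; exists (a * b); rewrite rmorphM.
pose h : ahom (free_alg A 'I_N) (free_alg A 'I_N.+1) :=
  free_hom (fun i => gen A (lift ord_max i)).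
pose S : calg (free_alg A 'I_N) := @CAlg _ (free_alg A 'I_N.+1) h.
apply: (@noetherian_adjoin _ S (gen A ord_max)) => //.
have cst r : exists n, @poly_upto _ S (gen A ord_max) n (h r).
  by exists 1%N, (fun=> r); rewrite big_ord1 mulr1.
apply: free_ind.
- by move=> a; rewrite -(ahom_map h); apply: cst.
- move=> v; case: (unliftP ord_max v) => [i ->|->].
    rewrite -[gen A (lift _ i)](free_hom_gen (fun i => gen A (lift ord_max i))).
    exact: cst.
  exists 2%N, (fun i => (i == 1%N)%:R).
  by rewrite !big_ord_recr big_ord0 /= rmorph0 rmorph1 mul0r mul1r !add0r.
- move=> y z [n ny] [k kz]; exists (maxn n k); apply: poly_uptoD.
    exact: poly_upto_leq (leq_maxl _ _) ny.
  exact: poly_upto_leq (leq_maxr _ _) kz.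
- by move=> y z; apply: poly_upto_closed.
Qed.

(** For any lift [y] of [y'], the element [k = y * x - 1] has square zero, so [1 - k] is inverse to
    [y * x = 1 + k]. *)
Lemma square_zero_unit (A : comPzRingType) (T T' : calg A) (p : ahom T T') x y' :
  square_zero_surj p -> y' * p x = 1 -> exists2 y, y * x = 1 & p y = y'.
Proof.
move=> [p_surj p0] yx; have [y yE] := p_surj y'; rewrite -yE in yx *.
have k0 : p (y * x - 1) = 0 by rewrite rmorphB rmorphM yx rmorph1 subrr.
exists ((1 - (y * x - 1)) * y); last first.
  by rewrite rmorphM rmorphB k0 rmorph1 subr0 mul1r.
have -> : (1 - (y * x - 1)) * y * x = 1 - (y * x - 1) * (y * x - 1) by ring.
by rewrite p0 // subr0.
Qed.

Lemma det_unit_inj (R : comPzRingType) q (M : 'M[R]_q) (y : R) (u : 'cV[R]_q) :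
  y * \det M = 1 -> M *m u = 0 -> u = 0.
Proof.
move=> yM Mu; rewrite -[u]mul1mx -yM -scale_scalar_mx -mul_adj_mx.
by rewrite -scalemxAl -mulmxA Mu mulmx0 scaler0.
Qed.

(** * Solving systems in henselian pairs *)

(* The system s_i = c_i + t p_i(s) becomes strictly etale once its Jacobian
   determinant is inverted; the inverse is the variable [gen R None]. *)
Section StrictlyEtale.
Variables (R : comPzRingType) (b : ideal R) (t : R) (bt : b t).
Variables (q : nat) (c : 'I_q -> R) (p : 'I_q -> free_alg R 'I_q).
Let Q := free_alg R 'I_q.
Let W := free_alg R (option 'I_q).

Definition hensel_eq (i : 'I_q) : Q :=
  gen R i + calg_map Q (- c i) + calg_map Q (- t) * p i.

Definition hensel_jac : 'M[Q]_q := \matrix_(i, j) pderiv j (hensel_eq i).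

Lemma hensel_jacE i j :
  hensel_jac i j = (i == j)%:R + calg_map Q (- t) * pderiv j (p i).
Proof.
rewrite mxE /hensel_eq !pderivD pderivM !pderiv_cst pderiv_gen addr0 mul0r.
by rewrite addr0.
Qed.

Definition hensel_emb : ahom Q W := free_hom (fun i => gen R (Some i)).

Definition hensel_rel : set W := [set g |
  (exists i, g = hensel_emb (hensel_eq i)) \/
  g = gen R None * hensel_emb (\det hensel_jac) - 1].

Definition hensel_alg : calg R := quot_alg (ideal_gen hensel_rel).

Let S := hensel_alg.
Let piS : ahom W S := quot_ahom (ideal_gen hensel_rel).

Let piS_surj : surj piS. Proof. exact: quot_pi_surj. Qed.

Let piS_eq i : piS (hensel_emb (hensel_eq i)) = 0.
Proof. by apply/quot_pi0; apply: ideal_gen_sub; left; exists i. Qed.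

Let piS_det : piS (gen R None) * piS (hensel_emb (\det hensel_jac)) = 1.
Proof.
apply/eqP; rewrite -subr_eq0 -rmorphM -{1}(rmorph1 piS) -rmorphB; apply/eqP.
by apply/quot_pi0; apply: ideal_gen_sub; right.
Qed.

Let piS_gen i : piS (gen R (Some i)) =
  calg_map S (c i) + calg_map S t * piS (hensel_emb (p i)).
Proof.
have := piS_eq i; rewrite /hensel_eq !rmorphD !rmorphM !ahom_map !rmorphN.
rewrite [hensel_emb (gen _ _)]free_hom_gen mulNr -addrA -opprD.
by move=> /eqP; rewrite subr_eq0 => /eqP.
Qed.

Lemma hensel_alg_lift (T : calg R) (f : ahom W T) :
  (forall i, f (hensel_emb (hensel_eq i)) = 0) ->
  f (gen R None) * f (hensel_emb (\det hensel_jac)) = 1 ->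
  exists g : ahom S T, forall x, g (piS x) = f x.
Proof.
move=> f_eq f_det; apply: factor_ahom => // x /quot_pi0.
apply: (@ideal_gen_min _ _ (ker f)) => _ [[i ->]|->]; first exact: f_eq.
by rewrite /ker /= rmorphB rmorphM f_det rmorph1 subrr.
Qed.

(** The Jacobian matrix is the identity plus a multiple of [t]. *)
Lemma hensel_jac_det (T : calg R) (f : ahom Q T) :
  calg_map T t = 0 -> f (\det hensel_jac) = 1.
Proof.
move=> t0; rewrite -det_map_mx -(det1 _ q); congr (\det _).
apply/matrixP => i j; rewrite mxE hensel_jacE rmorphD rmorphM ahom_map.
by rewrite rmorphN t0 oppr0 mul0r addr0 mxE rmorph_nat.
Qed.

Lemma hensel_alg_fg : finitely_generated S.
Proof.
exists [seq piS (gen R v) | v <- enum {: option 'I_q}].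
apply/seteqP; split=> // y _; have [x <-] := piS_surj y.
move=> K [KK Ks]; have [Kc KD KM] := KK.
apply: (@free_ind R (option 'I_q) [set x | K (piS x)]) => /=.
- by move=> a; rewrite (ahom_map piS).
- by move=> v; apply: Ks; apply: map_f; rewrite mem_enum.
- by move=> u v; rewrite (rmorphD piS); apply: KD.
- by move=> u v; rewrite (rmorphM piS); apply: KM.
Qed.

(** Over a square-zero extension the Taylor formula is exact to first order, so lifting a solution
    is a linear problem whose matrix, the Jacobian, is invertible. *)
Lemma hensel_alg_formally_etale : formally_etale S.
Proof.
move=> T T' pr [pr_surj pr0] f; split; last first.
  move=> g h gf hf.
  pose g' := ahom_comp (ahom_comp g piS) hensel_emb.
  pose h' := ahom_comp (ahom_comp h piS) hensel_emb.
  pose u (i : 'I_q) := g' (gen R i) - h' (gen R i).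
  have pu i : pr (u i) = 0 by rewrite rmorphB /= gf hf subrr.
  have uE i : g' (gen R i) = h' (gen R i) + u i by rewrite addrC subrK.
  have g'E := taylor_square_zero uE (fun i j => pr0 _ _ (pu i) (pu j)).
  (* Both lifts solve the system, so the Jacobian kills their difference [u]. *)
  have u0 : \col_i u i = 0.
    apply: (@det_unit_inj _ _ (map_mx h' hensel_jac) (h (piS (gen R None)))).
      by rewrite det_map_mx /= -rmorphM piS_det rmorph1.
    apply/colP => i; rewrite !mxE.
    transitivity (g' (hensel_eq i)); last by rewrite /= piS_eq rmorph0.
    rewrite g'E /= piS_eq rmorph0 add0r.
    by apply: eq_bigr => j _; rewrite !mxE.
  have gh' x : g' x = h' x.
    apply: free_hom_eq => i; rewrite uE.
    by move/colP/(_ i): u0; rewrite !mxE => ->; rewrite addr0.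
  (* Both sides are inverses of the same determinant. *)
  have ghN : g (piS (gen R None)) = h (piS (gen R None)).
    have gd : g (piS (gen R None)) * g' (\det hensel_jac) = 1.
      by rewrite /= -rmorphM piS_det rmorph1.
    have hd : h (piS (gen R None)) * g' (\det hensel_jac) = 1.
      by rewrite gh' /= -rmorphM piS_det rmorph1.
    by rewrite -[LHS]mulr1 -hd mulrCA gd mulr1.
  move=> x; have [y <-] := piS_surj x.
  apply: (@free_hom_eq _ _ _ (ahom_comp g piS) (ahom_comp h piS)) => -[i|] //=.
  have := gh' (gen R i); rewrite /= [hensel_emb _]free_hom_gen.
  by [].
pose F := ahom_comp f piS; pose F0 := ahom_comp F hensel_emb.
have /choice[e eF] : forall i, exists y, pr y = F0 (gen R i).
  by move=> i; apply: pr_surj.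
pose s0 : ahom Q T := free_hom e.
have s0F x : pr (s0 x) = F0 x.
  apply: (@free_hom_eq _ _ _ (ahom_comp pr s0) F0) => i.
  by rewrite /= [s0 _]free_hom_gen eF.
have F_det : F (gen R None) * F0 (\det hensel_jac) = 1.
  by rewrite /= -rmorphM piS_det rmorph1.
have [y0 y0d _] := square_zero_unit (conj pr_surj pr0)
  (etrans (congr1 _ (s0F (\det hensel_jac))) F_det).
pose M := map_mx s0 hensel_jac.
(* One Newton step: minus the inverse Jacobian, written with the adjugate, applied to the values of
   the equations at the arbitrary lift [s0]. *)
pose d := - (y0 *: (\adj M *m \col_i s0 (hensel_eq i))).
have Md : M *m d = - \col_i s0 (hensel_eq i).
  rewrite mulmxN -scalemxAr mulmxA mul_mx_adj mul_scalar_mx scalerA.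
  by rewrite det_map_mx y0d scale1r.
have prd i : pr (d i 0) = 0.
  rewrite !mxE rmorphN rmorphM rmorph_sum big1 ?mulr0 ?oppr0 // => j _.
  by rewrite !mxE rmorphM s0F /= piS_eq rmorph0 mulr0.
clearbody d.
pose s1 : ahom Q T := free_hom (fun i => e i + d i 0).
have s1E i : s1 (gen R i) = s0 (gen R i) + d i 0.
  by rewrite [LHS]free_hom_gen [s0 _]free_hom_gen.
have s1_eq i : s1 (hensel_eq i) = 0.
  rewrite (taylor_square_zero s1E (fun i j => pr0 _ _ (prd i) (prd j))).
  apply/eqP; rewrite addr_eq0 eq_sym eqr_oppLR; apply/eqP.
  move/colP/(_ i): Md; rewrite !mxE => <-.
  by apply: eq_bigr => j _; rewrite !mxE.
have s1F x : pr (s1 x) = F0 x.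
  apply: (@free_hom_eq _ _ _ (ahom_comp pr s1) F0) => i.
  by rewrite /= s1E rmorphD prd addr0 s0F.
(* The corrected point needs its own inverse of the determinant, to serve as the value of
   [gen R None]. *)
have [y1 y1d y1F] := square_zero_unit (conj pr_surj pr0)
  (etrans (congr1 _ (s1F (\det hensel_jac))) F_det).
pose s : ahom W T := free_hom (fun v => if v is Some i then s1 (gen R i) else y1).
have s_emb x : s (hensel_emb x) = s1 x.
  apply: (@free_hom_eq _ _ _ (ahom_comp s hensel_emb) s1) => i.
  by rewrite /= [hensel_emb _]free_hom_gen [LHS]free_hom_gen.
have [i||g gE] := @hensel_alg_lift T s; first by rewrite s_emb.
  by rewrite s_emb [s _]free_hom_gen.
exists g => x; have [y <-] := piS_surj x; rewrite gE.
apply: (@free_hom_eq _ _ _ (ahom_comp pr s) F) => -[i|] /=; last first.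
  by rewrite [s _]free_hom_gen.
by rewrite [s _]free_hom_gen s1F /= [hensel_emb _]free_hom_gen.
Qed.

(** Modulo [b] the equations read [s_i = c_i] and the determinant is 1, so only the constants
    remain. *)
Lemma hensel_alg_bij : bijective (quot_map (@ext_ideal_calg_map R b S)).
Proof.
set F := quot_map _.
have FE x : F (quot_pi b x) = quot_pi _ (calg_map S x) by apply: quot_mapE.
have F_inj : injective F.
  move=> u v; have [x <-] := quot_pi_surj u; have [y <-] := quot_pi_surj v.
  rewrite !FE => /quot_piP; rewrite -rmorphB => xy.
  pose T : calg R := @CAlg R (quot b) (quot_pi b).
  have t0 : calg_map T t = 0 by apply/quot_pi0.
  (* The point [s = c] over [R / b] gives a homomorphism from [S] to [R / b]; it kills [bS], whence
     injectivity. *)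
  pose f : ahom W T :=
    free_hom (fun v => if v is Some i then calg_map T (c i) else 1).
  have fN i : f (gen R i) = if i is Some i then calg_map T (c i) else 1.
    exact: free_hom_gen.
  have [i||g _] := @hensel_alg_lift T f.
  - rewrite /hensel_eq !rmorphD !rmorphM !ahom_map [hensel_emb _]free_hom_gen fN.
    by rewrite !rmorphN t0 oppr0 mul0r addr0; apply: subrr.
  - by rewrite fN mul1r; apply: (hensel_jac_det (ahom_comp f hensel_emb)).
  apply/quot_piP/quot_pi0.
  have /= <- := ahom_map g (x - y).
  apply: (@ideal_gen_min _ _ (ker g)) xy => _ [a ba <-].
  by rewrite /ker /= (ahom_map g); apply/quot_pi0.
have F_surj : surj F.
  move=> u; have [y <-] := quot_pi_surj u; have [x <-] := piS_surj y.
  pose T := quot_alg (ext_ideal b S).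
  suff [r rE] : exists r : R, quot_ahom (ext_ideal b S) (piS x) = calg_map T r.
    by exists (quot_pi b r); rewrite FE.
  have t0 : calg_map T t = 0.
    by apply/quot_pi0; apply: ideal_gen_sub; exists t.
  pose f : ahom W T := ahom_comp (quot_ahom (ext_ideal b S)) piS.
  (* Each generator is congruent to a constant: the solution variables to the [c i], the inverse of
     the determinant to 1. *)
  apply: (@free_ind R (option 'I_q) [set x | exists r, f x = calg_map T r]); rewrite /mkset.
  - by move=> a; exists a; rewrite (ahom_map f).
  - case=> [i|].
      exists (c i); rewrite /f /= piS_gen rmorphD rmorphM.
      rewrite (ahom_map (quot_ahom (ext_ideal b S))).
      rewrite (ahom_map (quot_ahom (ext_ideal b S))).
      by rewrite t0 mul0r addr0.
    have dE : f (hensel_emb (\det hensel_jac)) = 1.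
      exact: (hensel_jac_det (ahom_comp f hensel_emb)).
    exists 1; rewrite rmorph1 -[LHS]mulr1 -[X in _ * X]dE.
    by rewrite -(rmorphM (quot_pi (ext_ideal b S))) piS_det rmorph1.
  - move=> y1 y2 [r ur] [s vs]; exists (r + s).
    by rewrite rmorphD -ur -vs; exact: (rmorphD f).
  - move=> y1 y2 [r ur] [s vs]; exists (r * s).
    by rewrite rmorphM -ur -vs; exact: (rmorphM f).
exists (fun u => projT1 (cid (F_surj u))) => u.
  by apply: F_inj; apply: (projT2 (cid (F_surj _))).
exact: (projT2 (cid (F_surj _))).
Qed.

(** The retraction from [S] to [R] given by the henselian property sends the universal solution in
    [S] to a solution in [R]. *)
Lemma hensel_solve : henselian b -> exists th : ahom Q (self_alg R),
  forall i, th (gen R i) = c i + t * th (p i).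
Proof.
move=> /(_ S)[].
  split; last exact: hensel_alg_bij.
  by split; [apply: hensel_alg_fg|apply: hensel_alg_formally_etale].
move=> mu muE.
have mu_map a : mu (calg_map S a) = calg_map (self_alg R) a by apply: muE.
exists (ahom_comp (ahom_comp (@AHom R S (self_alg R) mu mu_map) piS) hensel_emb).
move=> i /=; rewrite [hensel_emb _]free_hom_gen piS_gen rmorphD rmorphM.
by rewrite [mu _]mu_map [mu _]mu_map.
Qed.

End StrictlyEtale.

(** * Nakayama's lemma for henselian pairs *)

Section HenselianPair.
Variables (R : comPzRingType) (b : ideal R) (t : R) (bt : b t).
Hypothesis henselR : henselian b.

(** The inverse is a solution of [y = 1 + t * (- x * y)], a system in one unknown of the form solved
    above. *)
Lemma henselian_unit x : exists y, y * (1 + t * x) = 1.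
Proof.
have [th thE] := hensel_solve bt (fun=> 1)
  (fun i : 'I_1 => calg_map (free_alg R 'I_1) (- x) * gen R i) henselR.
exists (th (gen R ord0)); move: (thE ord0).
rewrite rmorphM (ahom_map th) /=; set y := th _ => yE.
by rewrite mulrDr mulr1 {1}yE; ring.
Qed.

(** The matrix [1 - t L] has determinant congruent to 1 modulo [t], hence a unit, and it sends [v]
    into [I]; multiplying by its adjugate recovers [v]. *)
Lemma henselian_nakayama (I : ideal R) q (v : 'I_q -> R)
    (L : 'I_q -> 'I_q -> R) :
  (forall i, I (v i - t * \sum_j L i j * v j)) -> forall i, I (v i).
Proof.
move=> vE i.
pose M : 'M[R]_q := \matrix_(i, j) ((i == j)%:R - t * L i j).
have [x xE] : exists x, \det M = 1 + t * x.
  pose T : ideal R := ideal_gen [set t].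
  have : T (\det M - 1).
    apply/quot_piP; rewrite -det_map_mx -[X in quot_pi T X](det1 _ q) -det_map_mx.
    congr (\det _); apply/matrixP => k j; rewrite !mxE; apply/quot_piP.
    rewrite addrC addKr; apply: idealN; apply/ideal_genM1P.
    by exists (L k j).
  by move=> /ideal_genM1P[x xE]; exists x; rewrite -xE addrC subrK.
have [y yE] := henselian_unit x.
have -> : v i = y * (\adj M *m (M *m \col_j v j)) i 0.
  rewrite mulmxA mul_adj_mx mul_scalar_mx !mxE mulrA xE yE.
  by rewrite mul1r.
rewrite mxE; apply: ideal_mull; apply: ideal_sum => j _; apply: ideal_mull.
rewrite mxE (_ : \sum_k _ = v j - t * \sum_k L j k * v k); first exact: vE.
transitivity (\sum_k ((j == k)%:R * v k - t * (L j k * v k))).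
  by apply: eq_bigr => k _; rewrite !mxE; ring.
rewrite sumrB -big_distrr /=; congr (_ - _).
rewrite (bigD1 j) //= eqxx mul1r big1 ?addr0 // => k kj.
by rewrite eq_sym (negPf kj) mul0r.
Qed.

End HenselianPair.

(** * Smooth algebras and Newton approximation *)

Section LocalizationTheory.
Variables (R : comPzRingType) (t : R).

Lemma frac_eq0 x n : Defs.frac t x n = 0 <-> exists k, t ^+ k * x = 0.
Proof.
rewrite -[0]/(Defs.frac t 0 0) fracP; split=> -[k]; rewrite ?mulr0 ?expr0 ?mul1r => kx.
  by exists k.
by exists k; rewrite kx mulr0.
Qed.

Lemma frac_expand x n k : Defs.frac t x n = Defs.frac t (t ^+ k * x) (n + k).
Proof. by apply/fracP; exists 0%N; rewrite exprD; ring. Qed.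

Definition loc_in_fun (x : R) := Defs.frac t x 0.
Fact loc_in_zmod : zmod_morphism loc_in_fun.
Proof. by move=> x y; rewrite /loc_in_fun fracN fracD !mul1r. Qed.
Fact loc_in_monoid : monoid_morphism loc_in_fun.
Proof. by split=> // x y; rewrite /loc_in_fun fracM. Qed.
HB.instance Definition _ :=
  GRing.isZmodMorphism.Build R (loc t) loc_in_fun loc_in_zmod.
HB.instance Definition _ :=
  GRing.isMonoidMorphism.Build R (loc t) loc_in_fun loc_in_monoid.
Definition loc_in : {rmorphism R -> loc t} := loc_in_fun.

End LocalizationTheory.

Section LocalizationFunctor.
Variables (A : comPzRingType) (t : A) (D E : calg A) (g : ahom D E).

Definition loc_hom_fun (u : loc (calg_map D t)) : loc (calg_map E t) :=
  Defs.frac (calg_map E t) (g (loc_num u)) (loc_exp u).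

Lemma loc_hom_funE x n :
  loc_hom_fun (Defs.frac (calg_map D t) x n) = Defs.frac (calg_map E t) (g x) n.
Proof.
have /fracP[k e] := loc_fracK (Defs.frac (calg_map D t) x n).
by apply/fracP; exists k; rewrite -!(ahom_map g) -!(rmorphXn g) -!rmorphM e.
Qed.

Fact loc_hom_zmod : zmod_morphism loc_hom_fun.
Proof.
move=> u v; rewrite -(loc_fracK u) -(loc_fracK v) fracN fracD !loc_hom_funE.
by rewrite fracN fracD rmorphD !rmorphM !rmorphXn rmorphN (ahom_map g).
Qed.

Fact loc_hom_monoid : monoid_morphism loc_hom_fun.
Proof.
split=> [|u v]; first by rewrite -(@Defs.frac1 _ (calg_map D t)) loc_hom_funE rmorph1.
rewrite -(loc_fracK u) -(loc_fracK v).
by rewrite fracM !loc_hom_funE fracM rmorphM.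
Qed.

HB.instance Definition _ :=
  GRing.isZmodMorphism.Build (loc (calg_map D t)) (loc (calg_map E t))
    loc_hom_fun loc_hom_zmod.
HB.instance Definition _ :=
  GRing.isMonoidMorphism.Build (loc (calg_map D t)) (loc (calg_map E t))
    loc_hom_fun loc_hom_monoid.

Fact loc_hom_map a : (loc_hom_fun : {rmorphism _ -> _}) (calg_map (loc_alg t D) a)
  = calg_map (loc_alg t E) a.
Proof.
rewrite -(loc_fracK a).
transitivity (loc_hom_fun
    (Defs.frac (calg_map D t) (calg_map D (loc_num a)) (loc_exp a))).
  by congr loc_hom_fun; apply: loc_mapE.
by rewrite loc_hom_funE ahom_map; symmetry; apply: loc_mapE.
Qed.
Definition loc_hom : ahom (loc_alg t D) (loc_alg t E) :=
  @AHom (loc t) (loc_alg t D) (loc_alg t E) loc_hom_fun loc_hom_map.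

End LocalizationFunctor.

Section Smooth.
Variables (A : comPzRingType) (t : A) (B : calg A) (N : nat).
Let P := free_alg A 'I_N.
Variables (pi : ahom P B) (pi_surj : surj pi) (smoothB : smooth_off t B).

Definition ker_sq : ideal P := ideal_gen [set x * y | x in ker pi & y in ker pi].

Let D := quot_alg ker_sq.
Let tau := calg_map P t.
(** The ring of [loc_alg t D], here as an algebra over [A] so that it can receive homomorphisms from
    [P]. *)
Let T : calg A := @CAlg A (loc (calg_map D t)) (loc_in (calg_map D t) \o calg_map D).

(** The kernel of [(P / J^2)_t -> B_t] comes from [J / J^2] and has square zero, so smoothness
    provides a section. Its composition with [P -> B_t] is [be], which therefore kills [J]; one
    denominator serves all variables. *)
Let loc_section : exists (h : 'I_N -> P) (c : nat) (be : ahom P T),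
  [/\ forall i, pi (h i) = 0,
      forall i, be (gen A i) = Defs.frac (calg_map D t) (quot_pi ker_sq (gen A i)) 0
        + Defs.frac (calg_map D t) (quot_pi ker_sq (h i)) c
    & forall f, pi f = 0 -> be f = 0].
Proof.
have [|pr prE] := @factor_ahom A P D B (quot_ahom ker_sq) pi (@quot_pi_surj _ _).
  move=> x /quot_pi0; apply: (@ideal_gen_min _ _ (ker pi)) => _ [y + [z _ <-]].
  by rewrite /ker /= rmorphM => ->; rewrite mul0r.
have locE x n : loc_hom t pr (Defs.frac (calg_map D t) (quot_ahom ker_sq x) n) =
    Defs.frac (calg_map B t) (pi x) n.
  by rewrite [LHS]loc_hom_funE prE.
(* A fraction that vanishes in [B_t] is expanded by a power of t until its numerator comes from
   [J]. *)
have loc0 u : loc_hom t pr u = 0 ->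
    exists h n, pi h = 0 /\ u = Defs.frac (calg_map D t) (quot_ahom ker_sq h) n.
  rewrite -(loc_fracK u); have [x <-] := @quot_pi_surj _ ker_sq (loc_num u).
  rewrite [LHS]locE => /frac_eq0[k kx]; exists (tau ^+ k * x), (loc_exp u + k)%N.
  rewrite rmorphM rmorphXn /tau ahom_map kx; split=> //.
  by rewrite rmorphM rmorphXn (ahom_map (quot_ahom ker_sq)); apply: frac_expand.
have [|g gE] := (smoothB.2 (loc_alg t D) (loc_alg t B) (loc_hom t pr) _
    (@AHom _ (loc_alg t B) (loc_alg t B) idfun (fun=> erefl))).
  split=> [u|u v /loc0[h [n [h0 ->]]] /loc0[h' [n' [h'0 ->]]]].
    rewrite -(loc_fracK u); have [x <-] := pi_surj (loc_num u).
    by exists (Defs.frac (calg_map D t) (quot_ahom ker_sq x) (loc_exp u)); rewrite locE.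
  rewrite [LHS]fracM -(rmorphM (quot_ahom ker_sq)).
  suff -> : quot_ahom ker_sq (h * h') = 0 by apply/frac_eq0; exists 0%N; rewrite mulr0.
  by apply/quot_pi0; apply: ideal_gen_sub; exists h => //; exists h'.
pose be_fun : {rmorphism P -> T} :=
  (g : {rmorphism _ -> _}) \o (loc_in (calg_map B t) \o pi).
have be_map a : be_fun (calg_map P a) = calg_map T a.
  rewrite /be_fun /= (ahom_map pi).
  transitivity (g (calg_map (loc_alg t B) (Defs.frac t a 0))).
    by congr (g _); symmetry; apply: loc_mapE.
  by rewrite ahom_map; apply: (etrans (@loc_mapE A t D a 0)).
pose be := AHom be_map.
have /(@ex_uniform N (fun i n => exists2 h, pi h = 0 &
    be (gen A i) = Defs.frac (calg_map D t) (quot_pi ker_sq (gen A i)) 0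
        + Defs.frac (calg_map D t) (quot_pi ker_sq h) n))[] : forall i, exists n,
  exists2 h, pi h = 0 &
    be (gen A i) = Defs.frac (calg_map D t) (quot_pi ker_sq (gen A i)) 0
        + Defs.frac (calg_map D t) (quot_pi ker_sq h) n.
- move=> i; have /loc0[h [n [h0 hE]]] : loc_hom t pr
      (be (gen A i) - Defs.frac (calg_map D t) (quot_ahom ker_sq (gen A i)) 0) = 0.
    by rewrite rmorphB [X in X - _]gE locE subrr.
  exists n, h => //; rewrite -hE addrC.
  by rewrite subrK.
- move=> i c c' /subnKC<- [h h0 hE]; exists (tau ^+ (c' - c) * h).
    by rewrite rmorphM h0 mulr0.
  rewrite hE; congr (_ + _).
  by rewrite rmorphM rmorphXn; apply: frac_expand.
move=> c hP.
have /choice[h {}hP] : forall i, exists h, pi h = 0 /\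
    be (gen A i) = Defs.frac (calg_map D t) (quot_pi ker_sq (gen A i)) 0
      + Defs.frac (calg_map D t) (quot_pi ker_sq h) c.
  by move=> i; have [h] := hP i; exists h.
exists h, c, be; split=> [i|i|f f0]; [by case: (hP i)|by case: (hP i)|].
by rewrite /be /= f0 !rmorph0.
Qed.

Let al_map a : (loc_in (calg_map D t) \o quot_pi ker_sq) (calg_map P a) = calg_map T a.
Proof. by []. Qed.
Let al : ahom P T :=
  @AHom A P T (loc_in (calg_map D t) \o quot_pi ker_sq) al_map.

(* Lifting the identity of B_t to (P / J^2)_t sends X_i to X_i + h_i / t^c, and
   this must kill every f in J: Taylor's formula modulo J^2 gives the claim. *)
Lemma smooth_newton : exists (h : 'I_N -> P) (c : nat),
  (forall i, pi (h i) = 0) /\ forall f, pi f = 0 -> exists e,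
    ker_sq (tau ^+ e * (tau ^+ c * f + \sum_i pderiv i f * h i)).
Proof.
have [h [c [be [h0 beE be0]]]] := loc_section; exists h, c; split=> // f f0.
pose z : T := Defs.frac (calg_map D t) 1 c.
have alz : al (tau ^+ c) * z = 1.
  apply: (etrans (fracM _ _ _ _ _)); apply/fracP; exists 0%N.
  by rewrite !expr0 !mul1r mulr1 !mulr1 add0n rmorphXn.
have beE' i : be (gen A i) = al (gen A i) + al (h i) * z.
  rewrite beE; congr (_ + _); symmetry.
  by apply: (etrans (fracM _ _ _ _ _)); rewrite mulr1 add0n.
have hh i j : al (h i) * z * (al (h j) * z) = 0.
  rewrite mulrACA -rmorphM (_ : al (h i * h j) = 0) ?mul0r //.
  apply/frac_eq0; exists 0%N; rewrite expr0 mul1r; apply/quot_pi0.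
  by apply: ideal_gen_sub; exists (h i) => //; exists (h j).
have := be0 f f0; rewrite (taylor_square_zero beE' hh) => E.
have : al (tau ^+ c * f + \sum_i pderiv i f * h i) = 0.
  rewrite -[RHS](mulr0 (al (tau ^+ c))) -E mulrDr -rmorphM rmorphD.
  congr (_ + _); rewrite big_distrr rmorph_sum /=; apply: eq_bigr => i _.
  by rewrite !mulrA -[LHS]mul1r -alz rmorphM; ring.
move/frac_eq0 => [e eE]; exists e; apply/quot_pi0.
by rewrite rmorphM rmorphXn -eE.
Qed.

End Smooth.

(** The exponents [e] for the finitely many [f k] are made equal, then absorbed by replacing [h]
    with [t^e h] and [c] with [e + c]. *)
Lemma smooth_newton_uniform (A : comPzRingType) (t : A) (B : calg A) N
    (pi : ahom (free_alg A 'I_N) B) q (f : 'I_q -> free_alg A 'I_N) :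
  surj pi -> smooth_off t B -> (forall k, pi (f k) = 0) ->
  exists (h : 'I_N -> free_alg A 'I_N) (c : nat),
    (forall i, pi (h i) = 0) /\ forall k,
      ker_sq pi (calg_map _ t ^+ c * f k + \sum_i pderiv i (f k) * h i).
Proof.
move=> pi_surj smoothB f0; have [h [c [h0 hP]]] := smooth_newton pi_surj smoothB.
have [|k|e eP] := @ex_uniform q (fun k e => ker_sq pi (calg_map _ t ^+ e *
    (calg_map _ t ^+ c * f k + \sum_i pderiv i (f k) * h i))).
- by move=> k e e' /subnKC<- Ke; rewrite addnC exprD -mulrA; apply: ideal_mull.
- exact: hP.
exists (fun i => calg_map _ t ^+ e * h i), (e + c)%N; split=> [i|k].
  by rewrite rmorphM h0 mulr0.
suff <- : calg_map _ t ^+ e * (calg_map _ t ^+ c * f k +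
  \sum_i pderiv i (f k) * h i) = calg_map (free_alg A 'I_N) t ^+ (e + c) * f k +
   \sum_i pderiv i (f k) * (calg_map _ t ^+ e * h i) by [].
rewrite mulrDr mulrA exprD; congr (_ + _); rewrite big_distrr /=.
by apply: eq_bigr => i _; rewrite mulrCA.
Qed.

(** By the Leibniz rule, derivatives send the square of the kernel into the kernel. *)
Lemma pderiv_ker_sq (A : comPzRingType) (B : calg A) N
    (pi : ahom (free_alg A 'I_N) B) i f :
  ker_sq pi f -> pi (pderiv i f) = 0.
Proof.
move=> Kf; suff [] : pi f = 0 /\ pi (pderiv i f) = 0 by [].
apply: (@smallest_sub _ (@ideal_closed _) _
  [set f | pi f = 0 /\ pi (pderiv i f) = 0]) Kf.
  split=> [|x y [x0 dx0] [y0 dy0]|r x [x0 dx0]] /=.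
  - by rewrite -(rmorph0 (calg_map _)) pderiv_cst !rmorph0.
  - by rewrite pderivD !rmorphD x0 dx0 y0 dy0 addr0.
  - by rewrite pderivM rmorphD !rmorphM x0 dx0 !mulr0 addr0.
move=> _ [x x0 [y y0 <-]] /=.
by rewrite pderivM rmorphD !rmorphM x0 y0 !mulr0 mul0r addr0.
Qed.

Lemma ideal_gen_rangeP (R : comPzRingType) q (g : 'I_q -> R) y :
  ideal_gen (range g) y -> exists c : 'I_q -> R, y = \sum_l c l * g l.
Proof.
apply: (@smallest_sub _ (@ideal_closed R) _
  [set y | exists c : 'I_q -> R, y = \sum_l c l * g l]).
  split=> [|_ _ [c ->] [d ->]|r _ [c ->]].
  - by exists (fun=> 0); rewrite big1 // => l _; rewrite mul0r.
  - exists (fun l => c l + d l); rewrite -big_split.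
    by apply: eq_bigr => l _; rewrite mulrDl.
  - exists (fun l => r * c l); rewrite big_distrr.
    by apply: eq_bigr => l _; rewrite /= mulrA.
move=> _ [l _ <-]; exists (fun j => (j == l)%:R).
rewrite (bigD1 l) //= eqxx mul1r big1 ?addr0 // => j /negPf->.
by rewrite mul0r.
Qed.

Section Newton.
Variables (A : comPzRingType) (t : A) (B C : calg A) (N : nat).
Let P := free_alg A 'I_N.
Variables (pi : ahom P B) (b : ideal C).
Let s := calg_map C t.
Hypotheses (bs : b s) (henselC : henselian b).
Variables (I : ideal C) (h : 'I_N -> P) (c d : nat) (x a : 'I_N -> C).
Hypotheses (cd : (c < d)%N) (Ia : forall i, I (a i)).
Hypothesis hx : forall i, free_hom x (h i) = s ^+ (c + d) * a i.

(* Newton's equation [h (y) = (t ^ c + Dh (y)) (y - x)], of N equations in N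
   unknowns, at [y = x + t ^ d u]: its linear part in u is t ^ (c + d), and the
   remaining terms are divisible by a higher power of t. *)
Lemma newton_solve : exists u : 'I_N -> C, (forall i, I (u i)) /\
  let psi := free_hom (fun i => x i + s ^+ d * u i) in
  forall i, psi (h i) = s ^+ (c + d) * u i +
    \sum_l psi (pderiv l (h i)) * (s ^+ d * u l).
Proof.
pose Q := free_alg C 'I_N.
pose QA : calg A := @CAlg A Q (calg_map Q \o calg_map C).
pose S : Q := calg_map Q s.
pose X : ahom P QA := free_hom (fun i => calg_map Q (x i) : QA).
pose Y : ahom P QA := free_hom (fun i => calg_map Q (x i) + S ^+ d * gen C i : QA).
have XE f : X f = calg_map Q (free_hom x f).
  pose j : ahom C QA := @AHom A C QA (calg_map Q) (fun=> erefl).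
  apply: (@free_hom_eq _ _ _ X (ahom_comp j (free_hom x))) => i.
  by rewrite /= [LHS]free_hom_gen [fev _ _]free_hom_gen.
have YX i : Y (gen A i) = X (gen A i) + S ^+ d * gen C i.
  by rewrite [LHS]free_hom_gen [X _]free_hom_gen.
pose E i : Q := S ^+ (c + d) * gen C i - Y (h i) +
  \sum_l Y (pderiv l (h i)) * (S ^+ d * gen C l).
(* Beyond the linear part [t^(c+d) u], the equation has a remainder of second order in [t^d u], by
   [taylor2] for [h i] and [taylor1] for its derivatives. *)
have /choice[R RE] : forall i, exists R : 'I_N -> Q,
    E i - S ^+ (c + d) * gen C i + X (h i) =
    \sum_l R l * (S ^+ (d + d) * gen C l).
  move=> i; apply: ideal_gen_rangeP; set M := ideal_gen _.
  have Mg l z : M (z * (S ^+ (d + d) * gen C l)).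
    by apply: ideal_mull; apply: ideal_gen_sub; exists l.
  have -> : E i - S ^+ (c + d) * gen C i + X (h i) =
      \sum_l (Y (pderiv l (h i)) - X (pderiv l (h i))) * (S ^+ d * gen C l)
      - (Y (h i) - (X (h i) + \sum_l X (pderiv l (h i)) * (S ^+ d * gen C l))).
    under [X in _ = X - _]eq_bigr do rewrite mulrBl.
    by rewrite sumrB /E; ring.
  apply: idealB; last first.
    apply: (taylor2 YX) => v w.
    have -> : S ^+ d * gen C v * (S ^+ d * gen C w) =
        gen C v * (S ^+ (d + d) * gen C w) by rewrite exprD; ring.
    exact: Mg.
  apply: ideal_sum => l _.
  have /ideal_genM1P[z ->] : ideal_gen [set S ^+ d]
      (Y (pderiv l (h i)) - X (pderiv l (h i))).
    by apply: (taylor1 YX) => v; apply/ideal_genM1P; exists (gen C v).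
  have -> : S ^+ d * z * (S ^+ d * gen C l) = z * (S ^+ (d + d) * gen C l).
    by rewrite exprD; ring.
  exact: Mg.
(* As [c < d], [t^(2d)] is [t^(c+d)] times [t] times [t^((d-c).-1)]. Dividing by [t^(c+d)] thus
   leaves the system [u = a + t p(u)]. *)
pose p i : Q := - \sum_l S ^+ (d - c).-1 * R i l * gen C l.
have [th thE] := hensel_solve bs a p henselC.
pose u i : C := th (gen C i).
exists u; split.
  (* Each [p i] is linear in the variables with coefficients in [Q], so the solution satisfies
     [u - t L u = a], and Nakayama's lemma puts [u] in [I]. *)
  pose L i l : C := - (s ^+ (d - c).-1 * th (R i l)).
  apply: (henselian_nakayama bs henselC (L := L)) => i.
  rewrite {1}/u thE (_ : th (p i) = \sum_l L i l * u l) ?addrK //.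
  rewrite /p rmorphN rmorph_sum -sumrN; apply: eq_bigr => l _.
  by rewrite !rmorphM rmorphXn (ahom_map th) /L mulNr.
move=> psi.
have th_map r : (th : {rmorphism _ -> _}) (calg_map QA r) = calg_map C r.
  by rewrite [LHS](ahom_map th).
pose thA : ahom QA C := @AHom A QA C th th_map.
have psiE f : psi f = th (Y f).
  apply: (@free_hom_eq _ _ _ psi (ahom_comp thA Y)) => i.
  rewrite [LHS]free_hom_gen /= [fev _ _]free_hom_gen rmorphD rmorphM rmorphXn.
  by rewrite !(ahom_map th).
move=> i.
have : th (E i) = 0.
  have -> : E i = S ^+ (c + d) * (gen C i - calg_map Q (a i) - S * p i).
    have := RE i; rewrite XE hx rmorphM rmorphXn -/S =>  e.
    have {e}-> : E i = S ^+ (c + d) * gen C i - S ^+ (c + d) * calg_map Q (a i)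
        + \sum_l R i l * (S ^+ (d + d) * gen C l).
      by rewrite -e; ring.
    rewrite !mulrBr; congr (_ + _).
    rewrite /p !mulrN opprK !big_distrr /=; apply: eq_bigr => l _.
    have -> : (d + d = c + d + (d - c).-1.+1)%N.
      by rewrite prednK ?subn_gt0 // addnAC subnKC // ltnW.
    by rewrite exprD exprS; ring.
  rewrite rmorphM !rmorphB rmorphM !(ahom_map th) thE /=.
  by rewrite [a i + _]addrC addrK subrr mulr0.
rewrite /E rmorphD rmorphB rmorphM rmorphXn !(ahom_map th) -!psiE rmorph_sum.
move=> /eqP; rewrite addrAC subr_eq0 => /eqP <-; congr (_ + _).
by apply: eq_bigr => l _; rewrite !rmorphM rmorphXn (ahom_map th) -psiE.
Qed.

End Newton.

Section Approximation.
Variables (A : comPzRingType) (t : A) (B C : calg A) (N : nat).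
Let P := free_alg A 'I_N.
Variables (pi : ahom P B) (b : ideal C).
Let s := calg_map C t.
Hypotheses (pi_surj : surj pi) (smoothB : smooth_off t B) (noethA : noetherian A).
Hypotheses (bs : b s) (henselC : henselian b) (noethC : noetherian C).
Variables (I : ideal C) (n : nat).

(** The exponent [m] is chosen before [x], and the correction has coordinates in [I]. The theorem
    uses it with the whole ring for [Cbar], then with the kernel of [varphi] for [C]. *)
Lemma henselian_approx : exists m, forall x : 'I_N -> C,
  (forall f, pi f = 0 -> exists2 a, I a & free_hom x f = s ^+ m * a) ->
  exists g : ahom B C, forall i,
    exists2 u, I u & g (pi (gen A i)) = x i + s ^+ n * u.
Proof.
have [q [f [f0 fgen]]] := noetherian_gen (ker pi) (@noetherian_free A N noethA).
have [h [c [h0 hP]]] := smooth_newton_uniform pi_surj smoothB f0.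
have [e eP] := bounded_torsion noethC s (ker idfun).
(* Besides [s^c], the power [s^d] has to contain one factor [s] for Nakayama's lemma, [s^e] to kill
   torsion, and [s^n] for the precision. *)
pose d := (c + (n + e).+1)%N.
have cd : (c < d)%N by rewrite /d addnS ltnS leq_addr.
exists (c + d)%N => x xP.
have /choice[a aP] : forall i, exists a, I a /\ free_hom x (h i) = s ^+ (c + d) * a.
  by move=> i; have [a] := xP (h i) (h0 i); exists a.
have [u [Iu uE]] := newton_solve bs henselC cd (fun i => (aP i).1) (fun i => (aP i).2).
set psi := free_hom _ in uE.
have psi_gen i : psi (gen A i) = free_hom x (gen A i) + s ^+ d * u i.
  by rewrite [LHS]free_hom_gen [X in _ = X + _]free_hom_gen.
have psi_t g : pi g = 0 -> exists z, psi g = s ^+ d * z.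
  move=> g0; apply/ideal_genM1P; rewrite -(subrK (free_hom x g) (psi g)).
  apply: idealD.
    by apply: (taylor1 psi_gen) => v; apply/ideal_genM1P; exists (u v).
  have [z _ ->] := xP g g0; apply/ideal_genM1P; exists (s ^+ c * z).
  by rewrite exprD mulrCA mulrA.
(* In the notation of the introduction, this is the ideal [t^d J(y)]. *)
pose M : ideal C := ideal_gen (range (fun l => s ^+ d * psi (f l))).
have psiM g z : pi g = 0 -> M (psi g * (s ^+ d * z)).
  move=> /fgen[r ->]; rewrite rmorph_sum big_distrl; apply: ideal_sum => l _ /=.
  have -> : psi (r l * f l) * (s ^+ d * z) = psi (r l) * z * (s ^+ d * psi (f l)).
    by rewrite rmorphM; ring.
  by apply: (@ideal_mull _ M); apply: ideal_gen_sub; exists l.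
pose F k := calg_map P t ^+ c * f k + \sum_i pderiv i (f k) * h i.
(* Up to terms in the [h i], this is the derivative of [F k]. As [F k] is in [J^2], it lies in
   [J]. *)
pose w k l := calg_map P t ^+ c * pderiv l (f k) +
  \sum_i pderiv i (f k) * pderiv l (h i).
have w0 k l : pi (w k l) = 0.
  rewrite -(pderiv_ker_sq l (hP k)) pderivD pderiv_sum pderivM -rmorphXn.
  rewrite pderiv_cst mul0r addr0 rmorphXn /w !rmorphD; congr (_ + _).
  rewrite !rmorph_sum; apply: eq_bigr => i _.
  by rewrite pderivM rmorphD [X in _ = _ + X]rmorphM (h0 i) mulr0 addr0.
have psiF k : M (psi (F k)).
  pose K := preim_ideal psi M; apply: (@ideal_gen_min _ _ K) (hP k).
  move=> _ [y y0 [z z0 <-]]; rewrite /K /= rmorphM.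
  by have [v ->] := psi_t z z0; apply: psiM.
(* Newton's equation is substituted for [psi (h i)]; after exchanging the sums, the coefficient of
   [s^d u_l] is [psi (w k l)]. *)
have fE k : s ^+ c * psi (f k) = psi (F k) - \sum_l psi (w k l) * (s ^+ d * u l).
  have E : \sum_i psi (pderiv i (f k)) * psi (h i) =
      \sum_l psi (w k l) * (s ^+ d * u l).
    under eq_bigr do rewrite uE mulrDr big_distrr /=.
    rewrite big_split /= exchange_big /= -big_split /=.
    apply: eq_bigr => l _; rewrite /w rmorphD rmorphM rmorphXn (ahom_map psi).
    rewrite mulrDl rmorph_sum big_distrl /= exprD; congr (_ + _).
      by rewrite -/s; ring.
    by apply: eq_bigr => i _; rewrite rmorphM mulrA.
  rewrite -E /F rmorphD rmorphM rmorphXn (ahom_map psi) rmorph_sum /=.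
  under [X in _ = _ + X - _]eq_bigr do rewrite rmorphM.
  by rewrite addrK.
have /choice[L LE] : forall k, exists L : 'I_q -> C,
    s ^+ c * psi (f k) = \sum_l L l * (s ^+ d * psi (f l)).
  move=> k; apply: ideal_gen_rangeP; rewrite fE; apply: idealB; first exact: psiF.
  by apply: ideal_sum => l _; apply: psiM.
have cf0 k : s ^+ c * psi (f k) = 0.
  apply: (henselian_nakayama bs henselC (I := ker idfun)
    (v := fun k => s ^+ c * psi (f k)) (L := fun k l => L k l * s ^+ (n + e))).
  move=> {}k /=; rewrite {1}LE big_distrr -sumrB big1 // => l _.
  by rewrite /= /d exprD exprS; apply/eqP; rewrite subr_eq0; apply/eqP; ring.
(* With [psi (f k) = s^d z], the element [z] is torsion, so [s^e] kills it, and [e <= d]. *)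
have psif0 k : psi (f k) = 0.
  have [z zE] := psi_t (f k) (f0 k).
  have := eP (c + d)%N z; rewrite /ker /= exprD -mulrA -zE => /(_ (cf0 k)) ez.
  by rewrite zE /d addnS addnA -addSn exprD -mulrA ez mulr0.
have [g0|g gE] := @factor_ahom A P B C pi psi pi_surj.
  by move=> /fgen[r ->]; rewrite rmorph_sum big1 // => l _; rewrite rmorphM psif0 mulr0.
exists g => i; exists (s ^+ (c + e).+1 * u i); first exact: ideal_mull.
rewrite gE [LHS]free_hom_gen mulrA -exprD; congr (_ + _ ^+ _ * _).
by rewrite /d !addnS addnCA.
Qed.

End Approximation.

(** * Completions *)

Lemma finitely_generated_free (A : comPzRingType) (B : calg A) :
  finitely_generated B -> exists N (pi : ahom (free_alg A 'I_N) B), surj pi.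
Proof.
move=> [s sB]; pose pi := free_hom (fun i : 'I_(size s) => s`_i : B).
exists (size s), pi => y; have : [set: B] y by [].
rewrite -sB => sy; apply: (@smallest_sub _ (@Defs.subalg_closed A B) [set` s]
  [set y | exists x, pi x = y]) sy.
  split.
  - by move=> a; exists (calg_map _ a); rewrite (ahom_map pi).
  - by move=> _ _ [x <-] [z <-]; exists (x + z); rewrite rmorphD.
  - by move=> _ _ [x <-] [z <-]; exists (x * z); rewrite rmorphM.
move=> z /= zs; have zs' : (index z s < size s)%N by rewrite index_mem.
by exists (gen A (Ordinal zs')); rewrite [LHS]free_hom_gen /= nth_index.
Qed.

Section PrincipalCompletion.
Variables (A : comPzRingType) (t : A).
Let a := ideal_gen [set t].

Lemma ext_ideal_principal (C : calg A) x :
  ext_ideal a C x <-> exists z, x = calg_map C t * z.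
Proof.
rewrite -ideal_genM1P; split; apply: ideal_gen_min.
  move=> _ [y /ideal_genM1P[z ->] <-].
  by rewrite rmorphM; apply/ideal_genM1P; exists (calg_map C z).
by move=> _ ->; apply: ideal_gen_sub; exists t => //; apply: ideal_gen_sub.
Qed.

Lemma ext_ideal_pow_principal (C : calg A) n x :
  ideal_pow (ext_ideal a C) n x <-> exists z, x = calg_map C t ^+ n * z.
Proof. by apply: ideal_pow_principal => y; apply: ext_ideal_principal. Qed.

Definition hat_of (C : calg A) : ahom C (hat a C) :=
  @AHom A C (hat a C) (completion_of (ext_ideal a C)) (fun=> erefl).

Section Projection.
Variables (C : calg A) (n : nat).

Definition hat_proj_fun (u : hat a C) : quot (ideal_pow (ext_ideal a C) n) :=
  completion_val u n.
Fact hat_proj_zmod : zmod_morphism hat_proj_fun. Proof. by []. Qed.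
Fact hat_proj_monoid : monoid_morphism hat_proj_fun. Proof. by []. Qed.
HB.instance Definition _ :=
  GRing.isZmodMorphism.Build (hat a C) _ hat_proj_fun hat_proj_zmod.
HB.instance Definition _ :=
  GRing.isMonoidMorphism.Build (hat a C) _ hat_proj_fun hat_proj_monoid.
Fact hat_proj_map x : (hat_proj_fun : {rmorphism _ -> _}) (calg_map (hat a C) x)
  = calg_map (quot_alg (ideal_pow (ext_ideal a C) n)) x.
Proof. by []. Qed.
Definition hat_proj : ahom (hat a C) (quot_alg (ideal_pow (ext_ideal a C) n)) :=
  @AHom A (hat a C) (quot_alg (ideal_pow (ext_ideal a C) n)) hat_proj_fun hat_proj_map.

End Projection.

Lemma hat_proj_of (C : calg A) n x :
  hat_proj C n (hat_of C x) = quot_pi (ideal_pow (ext_ideal a C) n) x.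
Proof. by []. Qed.

Lemma hat_proj_leq (C : calg A) n m (u : hat a C) c : (n <= m)%N ->
  hat_proj C m u = quot_pi _ c -> hat_proj C n u = quot_pi _ c.
Proof.
move=> /subnK<-; elim: (m - n)%N => // k IHk E; apply: IHk.
apply: (etrans (esym (completionP u (k + n)))).
by apply: (etrans (congr1 _ E)); apply: quot_mapE.
Qed.

(** If [c k] represents [u] modulo [t^(n+k)], then [t^n] divides [c 0] and [t^(n+k)] divides
    [c (k+1) - c k]. Summing chosen quotients gives a compatible sequence; dividing each [c k]
    separately might not, as [t] may be a zero divisor. *)
Lemma hat_divisible (C : calg A) n (u : hat a C) : hat_proj C n u = 0 ->
  exists w, u = calg_map (hat a C) (t ^+ n) * w.
Proof.
pose s := calg_map C t; move=> u0.
have /choice[c cE] : forall k, exists c, hat_proj C (n + k) u = quot_pi _ c.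
  by move=> k; have [c] := quot_pi_surj (hat_proj C (n + k) u); exists c.
have /choice[z zE] : forall k, exists z, c k.+1 - c k = s ^+ (n + k) * z.
  move=> k; apply/ext_ideal_pow_principal/quot_piP; rewrite -cE; symmetry.
  by apply: hat_proj_leq (cE k.+1); rewrite addnS.
have [w0 w0E] : exists w0, c 0%N = s ^+ n * w0.
  apply/ext_ideal_pow_principal/quot_pi0; rewrite -u0; symmetry.
  by apply: hat_proj_leq (cE 0%N); rewrite addn0.
pose w k := w0 + \sum_(j < k) s ^+ j * z j.
have wE k : c k = s ^+ n * w k.
  elim: k => [|k IHk]; first by rewrite /w big_ord0 addr0.
  rewrite -[c k.+1](subrK (c k)) zE IHk /w big_ord_recr /= exprD; ring.
have w_compat k : quot_trans (ext_ideal a C) k (quot_pi _ (w k.+1)) = quot_pi _ (w k).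
  apply: (etrans (quot_mapE _ _)); apply/quot_piP/ext_ideal_pow_principal.
  by exists (z k); rewrite /w big_ord_recr /=; ring.
exists (Completion w_compat); apply: completion_eq => k.
have E : hat_proj C k u = quot_pi _ (c k).
  by apply: hat_proj_leq (cE k); apply: leq_addl.
rewrite [LHS]E wE rmorphM; congr (_ * _).
by rewrite /s -rmorphXn.
Qed.

Lemma hat_proj_eq0 (C : calg A) n (u : hat a C) : hat_proj C n u = 0 ->
  ext_ideal (ideal_pow a n) (hat a C) u.
Proof.
move=> /hat_divisible[w ->]; apply: ideal_mulr; apply: ideal_gen_sub.
exists (t ^+ n) => //; apply/(@ideal_pow_principal A t) => [y|].
  exact: ideal_genM1P.
by exists 1; rewrite mulr1.
Qed.

(** Every element of the completion of [B] is the image of some [y] in [B] plus a multiple of [t^n],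
    so the comparison reduces to the image of [B]. *)
Lemma hat_agree (B C : calg A) n (eps : ahom (hat a B) (hat a C)) (g : ahom B C) :
  (forall y, hat_proj C n (eps (hat_of B y)) = quot_pi _ (g y)) ->
  forall x, quot_pi (ext_ideal (ideal_pow a n) (hat a C)) (eps x)
    = quot_pi (ext_ideal (ideal_pow a n) (hat a C)) (hat_map a g x).
Proof.
move=> epsg x; apply/quot_piP.
have [y yE] := quot_pi_surj (hat_proj B n x).
have [|w wE] := @hat_divisible B n (x - hat_of B y).
  by rewrite rmorphB hat_proj_of -yE subrr.
have -> : eps x - hat_map a g x = calg_map (hat a C) (t ^+ n) *
    (eps w - hat_map a g w) + (eps (hat_of B y) - hat_map a g (hat_of B y)).
  rewrite -(subrK (hat_of B y) x) wE !rmorphD !rmorphM.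
  by rewrite (ahom_map eps) (ahom_map (hat_map a g)); ring.
apply: hat_proj_eq0; rewrite rmorphD rmorphM (ahom_map (hat_proj C n)).
have -> : calg_map (quot_alg (ideal_pow (ext_ideal a C) n)) (t ^+ n) = 0.
  apply/quot_pi0/ext_ideal_pow_principal; exists 1.
  by rewrite mulr1 rmorphXn.
rewrite mul0r add0r rmorphB epsg.
suff -> : hat_map a g (hat_of B y) = hat_of C (g y) by rewrite hat_proj_of subrr.
exact: completion_map_of.
Qed.

Lemma hat_proj_free (B C : calg A) N (pi : ahom (free_alg A 'I_N) B) m
    (eps : ahom (hat a B) (hat a C)) (x : 'I_N -> C) :
  (forall i, hat_proj C m (eps (hat_of B (pi (gen A i)))) = quot_pi _ (x i)) ->
  forall f, hat_proj C m (eps (hat_of B (pi f))) = quot_pi _ (free_hom x f).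
Proof.
move=> xE; apply: (@free_hom_eq _ _ _
  (ahom_comp (hat_proj C m) (ahom_comp eps (ahom_comp (hat_of B) pi)))
  (ahom_comp (quot_ahom (ideal_pow (ext_ideal a C) m)) (free_hom x))) => i.
by rewrite [RHS]/= [fev _ _]free_hom_gen; apply: xE.
Qed.

(** Representatives of the values of [eps] modulo [t^m] satisfy the equations of [B] modulo
    [t^m]. *)
Lemma hat_proj_free_ker (B C : calg A) N (pi : ahom (free_alg A 'I_N) B) m
    (eps : ahom (hat a B) (hat a C)) (x : 'I_N -> C) :
  (forall i, hat_proj C m (eps (hat_of B (pi (gen A i)))) = quot_pi _ (x i)) ->
  forall f, pi f = 0 -> exists z, free_hom x f = calg_map C t ^+ m * z.
Proof.
move=> xE f f0; apply/ext_ideal_pow_principal/quot_pi0.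
by rewrite -(hat_proj_free xE) f0 !rmorph0.
Qed.

End PrincipalCompletion.

(** * Construction of the two compatible homomorphisms *)

Theorem theorem28 (A : comPzRingType) (t : A)
  (a : ideal A) (aE : a = ideal_gen [set t]%classic)
  (B Bbar C Cbar : calg A)
  (noethA : noetherian A) (noethB : noetherian B) (noethBbar : noetherian Bbar)
  (noethC : noetherian C) (noethCbar : noetherian Cbar)
  (fgB : finitely_generated B) (fgBbar : finitely_generated Bbar)
  (phi : ahom B Bbar) (phi_surj : surj phi)
  (smoothB : smooth_off t B) (smoothBbar : smooth_off t Bbar)
  (I : ideal C) (varphi : ahom C Cbar)
  (exactC : forall x : C, I x <-> varphi x = 0) (exactCbar : surj varphi)
  (henselC : henselian (ext_ideal a C))
  (henselCbar : henselian (ext_ideal a Cbar))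
  (eps : ahom (hat a B) (hat a C))
  (epsbar : ahom (hat a Bbar) (hat a Cbar))
  (eps_comm : forall x, hat_map a varphi (eps x) = epsbar (hat_map a phi x))
  (n : nat) :
  exists (gamma : ahom B C) (gammabar : ahom Bbar Cbar),
    [/\ forall x, varphi (gamma x) = gammabar (phi x),
        forall x, quot_pi (ext_ideal (ideal_pow a n) (hat a C)) (eps x)
          = quot_pi (ext_ideal (ideal_pow a n) (hat a C)) (hat_map a gamma x)
      & forall x, quot_pi (ext_ideal (ideal_pow a n) (hat a Cbar)) (epsbar x)
          = quot_pi (ext_ideal (ideal_pow a n) (hat a Cbar))
              (hat_map a gammabar x)].
Proof.
subst a; set a := ideal_gen _ in eps epsbar eps_comm henselC henselCbar *.
have aC (D : calg A) : ext_ideal a D (calg_map D t).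
  by apply/ext_ideal_principal; exists 1; rewrite mulr1.
pose s := calg_map C t; pose sbar := calg_map Cbar t.
have [N [pi pi_surj]] := finitely_generated_free fgB.
pose pibar := ahom_comp phi pi.
have pibar_surj : surj pibar.
  by move=> y; have [x <-] := phi_surj y; have [z <-] := pi_surj x; exists z.
have [m mP] := henselian_approx pi_surj smoothB noethA (aC C) henselC noethC I n.
have [r rP] := bounded_torsion noethC s I.
(* [m] is the precision required over [C], [r] is lost to the torsion of [C / I], and [n] is the
   precision of the conclusion. *)
pose n1 := (m + r + n)%N.
have [m1 m1P] := henselian_approx pibar_surj smoothBbar noethA (aC Cbar)
  henselCbar noethCbar (Ideal (ideal_unit_closed Cbar)) n1.
(* Precision [m1] allows the approximation over [Cbar]; precision [n1] keeps [gbar] congruent to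
   [epsbar] modulo [t^n1]. *)
have /choice[xbar xbarE] : forall i, exists x,
    hat_proj t Cbar (m1 + n1) (epsbar (hat_of t Bbar (pibar (gen A i)))) = quot_pi _ x.
  by move=> i; have [x] := quot_pi_surj (hat_proj t Cbar (m1 + n1)
    (epsbar (hat_of t Bbar (pibar (gen A i))))); exists x.
have [f f0|gbar gbarE] := m1P xbar.
  have [z ->] := hat_proj_free_ker xbarE f0.
  by exists (sbar ^+ n1 * z) => //; rewrite exprD mulrA.
have gbar_eps i : hat_proj t Cbar n1 (epsbar (hat_of t Bbar (pibar (gen A i)))) =
    quot_pi _ (gbar (pibar (gen A i))).
  rewrite (hat_proj_leq _ (xbarE i)) ?leq_addl //; apply/quot_piP.
  have [u _ ->] := gbarE i; rewrite opprD addNKr; apply: idealN.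
  by apply/ext_ideal_pow_principal; exists u.
have eps_phi y : hat_map a varphi (eps (hat_of t B y)) = epsbar (hat_of t Bbar (phi y)).
  by rewrite eps_comm; congr (epsbar _); apply: completion_map_of.
have /choice[x xP] : forall i, exists x,
    hat_proj t C n1 (eps (hat_of t B (pi (gen A i)))) = quot_pi _ x /\
    varphi x = gbar (pibar (gen A i)).
  move=> i.
  have [c cE] := quot_pi_surj (hat_proj t C n1 (eps (hat_of t B (pi (gen A i))))).
  have /quot_piP/ext_ideal_pow_principal[y yE] :
      quot_pi (ideal_pow (ext_ideal a Cbar) n1) (varphi c) =
      quot_pi _ (gbar (pibar (gen A i))).
    rewrite -gbar_eps [pibar _]/= -eps_phi.
    rewrite /hat_proj /= /hat_proj_fun /= in cE *.
    by rewrite -cE; symmetry; apply: quot_mapE.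
  (* The error [sbar^n1 y] of [varphi c] is lifted and subtracted, so that the new point lies
     exactly over [gbar] without changing modulo [t^n1]. *)
  have [e eE] := exactCbar y; exists (c - s ^+ n1 * e); split.
    rewrite -cE; apply/quot_piP; rewrite subKr; apply/ext_ideal_pow_principal.
    by exists e.
  rewrite rmorphB rmorphM rmorphXn (ahom_map varphi) eE -yE.
  by rewrite subKr.
have [f f0|g gE] := mP x.
  have [z zE] := hat_proj_free_ker (fun i => (xP i).1) f0.
  have If : I (free_hom x f).
    apply/exactC.
    suff -> : varphi (free_hom x f) = gbar (pibar f) by rewrite /= f0 !rmorph0.
    apply: (@free_hom_eq _ _ _
      (ahom_comp varphi (free_hom x)) (ahom_comp gbar pibar)) => i.
    by rewrite [LHS]/= [fev _ _]free_hom_gen; case: (xP i).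
  (* Since [s^n1 z] lies in [I], so does [s^r z] by the choice of [r]; the remaining factor is
     [s^m]. *)
  exists (s ^+ (r + n) * z); last by rewrite zE mulrA -exprD /n1 addnA.
  rewrite addnC exprD -mulrA; apply: ideal_mull.
  apply: (rP (m + r + n)%N); rewrite -zE; exact: If.
have comm y : varphi (g y) = gbar (phi y).
  have [f <-] := pi_surj y.
  apply: (@free_hom_eq _ _ _
    (ahom_comp varphi (ahom_comp g pi)) (ahom_comp gbar pibar)) => i.
  have [_ xi] := xP i; have [u /exactC Iu giE] := gE i.
  (* The correction made by [g] is in [I], so it vanishes under [varphi]. *)
  by rewrite [LHS]/= giE rmorphD rmorphM Iu mulr0 addr0 xi.
have g_eps y : hat_proj t C n (eps (hat_of t B y)) = quot_pi _ (g y).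
  have [f <-] := pi_surj y.
  apply: (@free_hom_eq _ _ _
    (ahom_comp (hat_proj t C n) (ahom_comp eps (ahom_comp (hat_of t B) pi)))
    (ahom_comp (quot_ahom (ideal_pow (ext_ideal a C) n)) (ahom_comp g pi))) => i.
  have [xi _] := xP i; have [u _ giE] := gE i.
  apply: (etrans (hat_proj_leq _ xi)); first exact: leq_addl.
  apply: (etrans _ (congr1 _ (esym giE))); apply/quot_piP.
  rewrite opprD addNKr; apply: idealN.
  by apply/ext_ideal_pow_principal; exists u.
exists g, gbar; split=> //; apply: hat_agree => // y.
(* The congruence for [epsbar] is the image under [varphi] of the one for [eps], as [phi] is
   surjective. *)
have [z <-] := phi_surj y.
rewrite -eps_phi -comm; move: (g_eps z).
rewrite /hat_proj /= /hat_proj_fun /= => ->; exact: quot_mapE.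
Qed.
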